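(* Let $\mathcal P_t=e^{t\mathcal L}$ be a primitive quantum Markov semigroup satisfying the $\sigma$-GNS detailed balance condition for its full-rank invariant state $\sigma$, and let $p\in(1,2]$. Then the dual semigroup $\rho_t=e^{t\mathcal L^\dagger}(\rho)$, $\rho\in\mathcal D_+(\mathcal H)$, is the gradient flow of the quantum $p$-divergence $\mathcal F_{p,\sigma}$ with respect to the Riemannian metric $g_{p,\rho}$ on $\mathcal D_+(\mathcal H)$: $$\partial_t\rho_t=-\operatorname{grad}\mathcal F_{p,\sigma}(\rho_t)=\mathcal L^\dagger(\rho_t).$$
   Context: $\mathcal H$ is a Hilbert space of finite dimension $d$, $\mathcal D_+(\mathcal H)$ the full-rank density operators; $\dagger$ is the adjoint for $\langle X,Y\rangle=\mathrm{Tr}(X^*Y)$. A quantum Markov semigroup is a $C_0$-semigroup of completely positive unital maps on $\mathcal B(\mathcal H)$ with generator $\mathcal L$; primitive means there is a unique invariant state $\sigma$ ($\mathcal P_t^\dagger(\sigma)=\sigma$) and it is full rank; $\sigma$-GNS detailed balance means $\mathcal L$ is self-adjoint for $\mathrm{Tr}(\sigma X^*Y)$. By Alicki's theorem one can write (and a choice is fixed) $$\mathcal L(X)=\sum_{j=1}^J\big(e^{-\omega_j/2}V_j^*[X,V_j]+e^{\omega_j/2}[V_j,X]V_j^*\big),$$ with $\omega_j\in\mathbb R$, $\sigma V_j\sigma^{-1}=e^{-\omega_j}V_j$, $\mathrm{Tr}(V_j)=0$, $\langle V_j,V_k\rangle=c_j\delta_{jk}$, $c_j>0$, and for each $j$ an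 index $j'$ with $V_j^*=V_{j'}$, $\omega_{j'}=-\omega_j$. Let $\partial_jX=[V_j,X]$, so $\partial_j^\dagger Y=[V_j^*,Y]$. Let $\Gamma_\sigma^s(X)=\sigma^{s/2}X\sigma^{s/2}$, $\hat p=p/(p-1)$, $\|X\|_{p,\sigma}=\mathrm{Tr}(|\Gamma_\sigma^{1/p}(X)|^p)^{1/p}$, and $\mathcal F_{p,\sigma}(\rho)=\frac1{p(p-1)}\big(\|\Gamma_\sigma^{-1}(\rho)\|_{p,\sigma}^p-1\big)$. For $x,y>0$ let $\theta_p(x,y)=(p-1)\frac{x-y}{x^{p-1}-y^{p-1}}$ if $x\ne y$ and $\theta_p(x,x)=x^{2-p}$. For self-adjoint $A=\sum_i\lambda_iA_i$, $B=\sum_k\mu_kB_k$ (spectral decompositions) and a function $f$, $f(A,B)(X)=\sum_{i,k}f(\lambda_i,\mu_k)A_iXB_k$. For $\rho\in\mathcal D_+(\mathcal H)$ and $\omega\in\mathbb R$ define $$[\rho]_{p,\omega}=\Gamma_\sigma^{1/\hat p}\circ\theta_p\big(e^{\omega/2p}\Gamma_\sigma^{-1/\hat p}(\rho),\,e^{-\omega/2p}\Gamma_\sigma^{-1/\hat p}(\rho)\big)\circ\Gamma_\sigma^{1/\hat p},\qquad \mathfrak D_{p,\rho}(A)=\sum_{j=1}^J\partial_j^\dagger\big([\rho]_{p,\omega_j}\partial_jA\big).$$ The tangent space of $\mathcal D_+(\mathcal H)$ at $\rho$ is $T_\rho=\mathcal B^0_{sa}(\mathcal H)$, the traceless self-adjoint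 operators; $\mathfrak D_{p,\rho}$ is positive definite on it, and the metric is $g_{p,\rho}(\nu_1,\nu_2)=\langle\mathfrak D_{p,\rho}^{-1}(\nu_1),\nu_2\rangle$. The Riemannian gradient $\operatorname{grad}\mathcal F_{p,\sigma}(\rho)\in T_\rho$ is defined by $g_{p,\rho}(\operatorname{grad}\mathcal F_{p,\sigma}(\rho),\nu)=\frac{d}{d\varepsilon}\big|_{\varepsilon=0}\mathcal F_{p,\sigma}(\rho+\varepsilon\nu)$ for all $\nu\in T_\rho$. *)

(* Defs.v *)
From HB Require Import structures.
From mathcomp Require Import all_boot all_order all_algebra.
From mathcomp Require Export complex.
From mathcomp Require Import all_classical all_reals all_analysis.

Set Implicit Arguments.
Unset Strict Implicit.
Unset Printing Implicit Defensive.

Import Order.TTheory GRing.Theory Num.Theory numFieldNormedType.Exports.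

Local Open Scope classical_set_scope.
Local Open Scope ring_scope.
Local Open Scope complex_scope.
Local Open Scope sesquilinear_scope.

(* The norm topology of R[i], from which 'M[R[i]]_d gets its topology. *)
HB.instance Definition _ (R : realType) := NormedModule.copy R[i] R[i]^o.

(* B(H) is 'M[R[i]]_d, i.e. H is C^d through an orthonormal basis. *)

Section Operators.
Context {R : realType} {d : nat}.
Local Notation M := 'M[R[i]]_d.

Definition hsdot (X Y : M) : R[i] := \tr (X ^t* *m Y).

(* The adjoint of a superoperator T for hsdot; its (i, j) entry is
   <E_ij, T^dagger Y> = <T E_ij, Y>. See hsdot_superadj. *)
Definition superadj (T : M -> M) (Y : M) : M :=
  \matrix_(i, j) hsdot (T (delta_mx i j)) Y.

Lemma hsdot_superadj (T : {linear M -> M}) (X Y : M) :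
  hsdot (T X) Y = hsdot X (superadj T Y).
Proof.
have hsE (A B : M) : hsdot A B = \sum_i \sum_j (A i j)^* * B i j.
  rewrite exchange_big; apply: eq_bigr => j _.
  by rewrite mxE; apply: eq_bigr => i _; rewrite !mxE.
rewrite [RHS]hsE {1}(matrix_sum_delta X) hsE linear_sum.
under eq_bigr => a _ do under eq_bigr => b _ do
  rewrite summxE rmorph_sum mulr_suml.
under eq_bigr => a _ do rewrite exchange_big.
rewrite exchange_big; apply: eq_bigr => i _ /=.
under eq_bigr => a _ do under eq_bigr => b _ do
  rewrite linear_sum summxE rmorph_sum mulr_suml.
under eq_bigr => a _ do rewrite exchange_big.
rewrite exchange_big; apply: eq_bigr => j _ /=.
rewrite mxE hsE mulr_sumr; apply: eq_bigr => a _.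
rewrite mulr_sumr; apply: eq_bigr => b _.
by rewrite linearZ mxE rmorphM mulrA.
Qed.

Definition comm (A B : M) : M := A *m B - B *m A.

(* Spectral decomposition A = \sum_i spval A i *: spproj A i, indexed by an
   orthonormal eigenbasis, so eigenvalues are repeated with multiplicity and
   each projection has rank one. *)
Definition spval (A : M) (i : 'I_d) : R := complex.Re (spectral_diag A 0 i).

Definition spproj (A : M) (i : 'I_d) : M :=
  (row i (spectralmx A)) ^t* *m row i (spectralmx A).

Lemma spectral_sum (A : M) : A \is hermsymmx ->
  A = \sum_i (spval A i)%:C *: spproj A i.
Proof.
move=> Ah; have /orthomx_spectralP {1}-> := hermitian_normalmx Ah.
rewrite invmx_unitary ?spectral_unitarymx//.
apply/matrixP => a b; rewrite summxE mxE; apply: eq_bigr => i _.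
have /mxOverP/(_ 0 i) Ar := hermitian_spectral_diag_real Ah.
have -> : (spval A i)%:C = spectral_diag A 0 i by exact: RRe_real.
rewrite mul_mx_diag !mxE big_ord1 !mxE.
by rewrite mulrAC mulrC.
Qed.

Definition mxfun (f : R -> R) (A : M) : M :=
  \sum_i (f (spval A i))%:C *: spproj A i.

Definition mxfun2 (f : R -> R -> R) (A B X : M) : M :=
  \sum_i \sum_k (f (spval A i) (spval B k))%:C *: (spproj A i *m X *m spproj B k).

Definition mxpow (A : M) (s : R) : M := mxfun (fun x => x `^ s) A.

Definition mxabs (X : M) : M := mxfun Num.sqrt (X ^t* *m X).

(* e^{tT}, by the power series *)
Definition superexp (t : R) (T : M -> M) (X : M) : M :=
  lim (series (fun n : nat => (t ^+ n / n`!%:R)%:C *: iter n T X) @ \oo).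

(* Curves are parametrized by R while M is a normed module over R[i] only,
   hence the explicit difference quotient. *)
Definition mx_deriv_at (f : R -> M) (t : R) (D : M) : Prop :=
  (h^-1)%:C *: (f (t + h) - f t) @[h --> (0 : R)^'] --> D.

End Operators.

Definition psdmx {R : realType} {n : nat} (A : 'M[R[i]]_n) : Prop :=
  A \is hermsymmx /\ forall v : 'cV[R[i]]_n, 0 <= (v ^t* *m A *m v) 0 0.

Section Semigroups.
Context {R : realType} {d : nat}.
Local Notation M := 'M[R[i]]_d.

Definition density (rho : M) : Prop := psdmx rho /\ \tr rho = 1.

Definition fullrank_density (rho : M) : Prop := density rho /\ \rank rho = d.

Definition tangent (nu : M) : Prop := nu \is hermsymmx /\ \tr nu = 0.

(* The block matrices are the elements of M_n(B(H)). *)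
Definition completely_positive (T : M -> M) : Prop :=
  forall (n : nat) (B : 'I_n -> 'I_n -> M),
    psdmx (\mxblock_(i < n, j < n) B i j) ->
    psdmx (\mxblock_(i < n, j < n) T (B i j)).

Definition is_qms (P : R -> {linear M -> M}) : Prop :=
  [/\ (forall X, P 0 X = X),
      (forall s t : R, 0 <= s -> 0 <= t -> forall X, P (s + t) X = P s (P t X)),
      (forall X, P t X @[t --> (0 : R)^'+] --> X),
      (forall t : R, 0 <= t -> completely_positive (P t))
    & (forall t : R, 0 <= t -> P t 1%:M = 1%:M)].

Definition is_generator (P : R -> {linear M -> M}) (L : M -> M) : Prop :=
  forall X, (t^-1)%:C *: (P t X - X) @[t --> (0 : R)^'+] --> L X.

Definition invariant_state (P : R -> {linear M -> M}) (rho : M) : Prop :=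
  density rho /\ forall t : R, 0 <= t -> superadj (P t) rho = rho.

Definition primitive (P : R -> {linear M -> M}) (sigma : M) : Prop :=
  [/\ invariant_state P sigma,
      (forall tau, invariant_state P tau -> tau = sigma)
    & \rank sigma = d].

Definition gns_detailed_balance (sigma : M) (L : M -> M) : Prop :=
  forall X Y, \tr (sigma *m (L X) ^t* *m Y) = \tr (sigma *m X ^t* *m L Y).

Record alicki_form (sigma : M) (L : M -> M) (J : nat)
    (V : 'I_J -> M) (omega c : 'I_J -> R) : Prop := AlickiForm {
  alicki_gen : forall X, L X =
    \sum_j ((expR (- omega j / 2))%:C *: ((V j) ^t* *m comm X (V j))
            + (expR (omega j / 2))%:C *: (comm (V j) X *m (V j) ^t*));
  alicki_modular : forall j,
    sigma *m V j *m invmx sigma = (expR (- omega j))%:C *: V j;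
  alicki_traceless : forall j, \tr (V j) = 0;
  alicki_orthogonal : forall j k,
    hsdot (V j) (V k) = if j == k then (c j)%:C else 0;
  alicki_pos : forall j, 0 < c j;
  alicki_adjoint : forall j, exists j',
    (V j) ^t* = V j' /\ omega j' = - omega j }.

End Semigroups.

Section Geometry.
Context {R : realType} {d : nat}.
Local Notation M := 'M[R[i]]_d.
Variables (p : R) (sigma : M).

Definition hatp : R := p / (p - 1).

Definition Gamma (s : R) (X : M) : M :=
  mxpow sigma (s / 2) *m X *m mxpow sigma (s / 2).

Definition pnorm (X : M) : R :=
  (complex.Re (\tr (mxpow (mxabs (Gamma p^-1 X)) p))) `^ p^-1.

Definition pdivergence (rho : M) : R :=
  (p * (p - 1))^-1 * ((pnorm (Gamma (-1) rho)) `^ p - 1).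

Definition theta (x y : R) : R :=
  if x == y then x `^ (2 - p)
  else (p - 1) * ((x - y) / (x `^ (p - 1) - y `^ (p - 1))).

(* [rho]_{p,w} *)
Definition mult_op (rho : M) (w : R) (X : M) : M :=
  let Y := Gamma (- hatp^-1) rho in
  Gamma hatp^-1
    (mxfun2 theta ((expR (w / (2 * p)))%:C *: Y)
                  ((expR (- w / (2 * p)))%:C *: Y)
       (Gamma hatp^-1 X)).

Variables (J : nat) (V : 'I_J -> M) (omega : 'I_J -> R).

Definition Dop (rho A : M) : M :=
  \sum_j superadj (comm (V j)) (mult_op rho (omega j) (comm (V j) A)).

(* The inverse of Dop rho on the traceless self-adjoint operators. *)
Definition Dop_inv (rho nu : M) : M :=
  xget 0 [set A | tangent A /\ Dop rho A = nu].

(* The trace is real on self-adjoint operators. *)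
Definition metric (rho nu1 nu2 : M) : R :=
  complex.Re (hsdot (Dop_inv rho nu1) nu2).

Definition is_grad (rho G : M) : Prop :=
  tangent G /\ forall nu, tangent nu ->
    is_derive (0 : R) (1 : R) (fun e : R => pdivergence (rho + e%:C *: nu))
      (metric rho G nu).

Definition grad (rho : M) : M := xget 0 [set G | is_grad rho G].

End Geometry.

(* Main.v *)
From HB Require Import structures.
Require Import Defs.
From mathcomp Require Import all_boot all_order all_algebra.
From mathcomp Require Import all_classical all_reals all_analysis.
From mathcomp Require Import ring lra.
Set Implicit Arguments.
Unset Strict Implicit.
Unset Printing Implicit Defensive.
Import Order.TTheory GRing.Theory Num.Theory numFieldNormedType.Exports.
Local Open Scope classical_set_scope.
Local Open Scope ring_scope.
Local Open Scope complex_scope.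
Local Open Scope sesquilinear_scope.

(** The divergence is a function of the trace of a power of the weighted density
    [Y = sigma^(-1/2p') rho sigma^(-1/2p')], where [1/p + 1/p' = 1]. Its
    differential at [rho] is therefore represented in the Hilbert-Schmidt product
    by the potential [A = sigma^(-1/2p') Y^(p-1) sigma^(-1/2p') / (p-1)]
    ([is_derive_pdivergence]). The metric is the inverse of the operator
    [D = sum_j [V_j', [rho]_j [V_j, .]]], so the gradient is [D A], and the claim
    is that [D A] is minus the dual generator at [rho].

    The modular relation [sigma V_j = e^(-w_j) V_j sigma] lets powers of [sigma]
    pass through [V_j]. Thus [[V_j, A]] becomes, after removing the weights,
    the difference [V_j B^(p-1) - B'^(p-1) V_j] for two multiples [B], [B'] of [Y].
    The kernel [theta] in [[rho]_j] is exactly the ratio of the increments of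
    [x] and [x^(p-1)], hence turns it into [V_j B - B' V_j], and restoring the
    weights gives [e^(-w_j/2) V_j rho - e^(w_j/2) rho V_j]
    ([mult_op_comm_potential]). The sum of the commutators of these fluxes with
    the adjoints [V_j'] is minus the dual generator by direct computation
    ([superadj_alicki], [Dop_potential]).

    For the gradient to be well defined, [D] must be a bijection of the tangent
    space ([Dop_bij]). It is a sum of squares, so its kernel commutes with all
    [V_j]. If a self-adjoint [A] does, then [sigma^(1/2) A sigma^(1/2)] is
    annihilated by the dual generator, and primitivity forces [A] to be a scalar
    ([commutant_scalar]).

    Differentiability of the trace of a power rests on a scalar inequality of
    second order ([powR_tangent]), averaged over the overlaps of two eigenbases
    ([trace_power_expansion]).

    Finally the curve [exp (t L')], with [L'] the dual generator, must stay inside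
    the positive definite states. A telescoping argument identifies it with
    the dual of [P t] ([superadj_semigroup]). The latter is positive and trace
    preserving, and keeps full rank because [sigma] is invariant and of full
    rank ([superadj_posdef]). *)

(** * Adjoints, traces and the Hilbert-Schmidt product *)

Section Adjoint.
Context {R : realType}.
Local Notation C := R[i].

Lemma dagE m n (A : 'M[C]_(m, n)) i j : (A ^t*) i j = (A j i)^*%C.
Proof. by rewrite !mxE. Qed.

Lemma dagK m n (A : 'M[C]_(m, n)) : (A ^t*) ^t* = A.
Proof. exact: trmxCK. Qed.

Lemma dagM m n q (A : 'M[C]_(m, n)) (B : 'M[C]_(n, q)) :
  (A *m B) ^t* = B ^t* *m A ^t*.
Proof. by rewrite trmx_mul map_mxM. Qed.

Lemma dagD m n (A B : 'M[C]_(m, n)) : (A + B) ^t* = A ^t* + B ^t*.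
Proof. by rewrite linearD /= map_mxD. Qed.

Lemma dagB m n (A B : 'M[C]_(m, n)) : (A - B) ^t* = A ^t* - B ^t*.
Proof. by rewrite linearB /= map_mxB. Qed.

Lemma dagZ m n (a : C) (A : 'M[C]_(m, n)) : (a *: A) ^t* = a^*%C *: A ^t*.
Proof. by rewrite linearZ /= map_mxZ. Qed.

Lemma dagZr m n (a : R) (A : 'M[C]_(m, n)) : (a%:C *: A) ^t* = a%:C *: A ^t*.
Proof. by rewrite dagZ conjc_real. Qed.

Lemma dag_sum m n (I : finType) (F : I -> 'M[C]_(m, n)) :
  (\sum_i F i) ^t* = \sum_i (F i) ^t*.
Proof.
apply/matrixP => i j; rewrite dagE !summxE rmorph_sum /=.
by apply: eq_bigr => k _; rewrite dagE.
Qed.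

Lemma dag1 n : (1%:M : 'M[C]_n) ^t* = 1%:M.
Proof. by apply/matrixP => i j; rewrite dagE !mxE eq_sym conjc_nat. Qed.

Lemma tr_dag n (A : 'M[C]_n) : \tr (A ^t*) = (\tr A)^*%C.
Proof.
by rewrite /mxtrace rmorph_sum /=; apply: eq_bigr => k _; rewrite dagE.
Qed.

Lemma mxtraceB n (A B : 'M[C]_n) : \tr (A - B) = \tr A - \tr B.
Proof. exact: raddfB. Qed.

Lemma hermP n (A : 'M[C]_n) : reflect (A ^t* = A) (A \is hermsymmx).
Proof.
apply: (iffP (is_hermitianmxP _ _ _)); rewrite expr0 scale1r; first by move=> {2}->.
by move=> ->.
Qed.

End Adjoint.

Section HilbertSchmidt.
Context {R : realType} {d : nat}.
Local Notation C := R[i].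
Local Notation M := 'M[C]_d.

Lemma hsdotE (X Y : M) : hsdot X Y = \sum_i \sum_j (X i j)^*%C * Y i j.
Proof.
rewrite exchange_big; apply: eq_bigr => j _.
by rewrite mxE; apply: eq_bigr => i _; rewrite dagE.
Qed.

Lemma hsdotDr (X Y Z : M) : hsdot X (Y + Z) = hsdot X Y + hsdot X Z.
Proof. by rewrite /hsdot mulmxDr raddfD. Qed.

Lemma hsdotBr (X Y Z : M) : hsdot X (Y - Z) = hsdot X Y - hsdot X Z.
Proof. by rewrite /hsdot mulmxBr raddfB. Qed.

Lemma hsdotDl (X Y Z : M) : hsdot (X + Y) Z = hsdot X Z + hsdot Y Z.
Proof. by rewrite /hsdot dagD mulmxDl raddfD. Qed.

Lemma hsdotBl (X Y Z : M) : hsdot (X - Y) Z = hsdot X Z - hsdot Y Z.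
Proof. by rewrite /hsdot dagB mulmxBl raddfB. Qed.

Lemma hsdotZr a (X Y : M) : hsdot X (a *: Y) = a * hsdot X Y.
Proof. by rewrite /hsdot -scalemxAr linearZ. Qed.

Lemma hsdotZl a (X Y : M) : hsdot (a *: X) Y = a^*%C * hsdot X Y.
Proof. by rewrite /hsdot dagZ -scalemxAl linearZ. Qed.

Lemma hsdot0r (X : M) : hsdot X 0 = 0.
Proof. by rewrite /hsdot mulmx0 raddf0. Qed.

Lemma hsdot_sumr (I : finType) (X : M) (F : I -> M) :
  hsdot X (\sum_i F i) = \sum_i hsdot X (F i).
Proof. by rewrite /hsdot mulmx_sumr raddf_sum. Qed.

Lemma hsdot_delta i j (Y : M) : hsdot (delta_mx i j) Y = Y i j.
Proof.
rewrite hsdotE (bigD1 i)//= (bigD1 j)//= mxE !eqxx conjc_nat mul1r.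
rewrite big1 ?addr0; last first.
  by move=> k /negbTE kj; rewrite mxE kj andbF conjc_nat mul0r.
rewrite big1 ?addr0// => k /negbTE ki; rewrite big1// => l _.
by rewrite mxE ki conjc_nat mul0r.
Qed.

Lemma hsdot_normE (X : M) :
  hsdot X X = (\sum_i \sum_j (complex.Re (X i j) ^+ 2 + complex.Im (X i j) ^+ 2))%:C.
Proof.
rewrite hsdotE rmorph_sum; apply: eq_bigr => i _.
rewrite rmorph_sum; apply: eq_bigr => j _ /=.
by rewrite add_Re2_Im2 sqr_normc mulrC.
Qed.

Lemma hsdot_ge0 (X : M) : 0 <= hsdot X X.
Proof.
rewrite hsdot_normE lecR; apply: sumr_ge0 => i _; apply: sumr_ge0 => j _.
by rewrite addr_ge0 ?sqr_ge0.
Qed.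


(** Testing against the matrix units recovers every entry of the adjoint. *)
Lemma superadj_unique (T : M -> M) (Y Z : M) :
  (forall X, hsdot (T X) Y = hsdot X Z) -> superadj T Y = Z.
Proof. by move=> H; apply/matrixP => i j; rewrite mxE H hsdot_delta. Qed.

Lemma superadj_is_linear (T : M -> M) : linear (superadj T).
Proof.
by move=> a Y Z; apply/matrixP => i j; rewrite !mxE hsdotDr hsdotZr.
Qed.

HB.instance Definition _ (T : M -> M) :=
  GRing.isLinear.Build C M M *:%R (superadj T) (superadj_is_linear T).

Lemma comm_is_linear (A : M) : linear (comm A).
Proof.
move=> a X Y; rewrite /comm mulmxDr mulmxDl -scalemxAr -scalemxAl scalerBr.
by rewrite opprD addrACA.
Qed.

HB.instance Definition _ (A : M) :=
  GRing.isLinear.Build C M M *:%R (comm A) (comm_is_linear A).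

Lemma superadj_comm (A Y : M) : superadj (comm A) Y = comm (A ^t*) Y.
Proof.
apply: superadj_unique => X; rewrite /hsdot /comm dagB !dagM mulmxBl mulmxBr.
rewrite 2!mxtraceB -2!mulmxA; congr (_ - _).
by rewrite mxtrace_mulC -mulmxA.
Qed.

Lemma comm_dag (A X : M) : (comm A X) ^t* = - comm (A ^t*) (X ^t*).
Proof. by rewrite /comm dagB !dagM opprB. Qed.

Lemma tr_comm (A X : M) : \tr (comm A X) = 0.
Proof. by rewrite raddfB /= mxtrace_mulC subrr. Qed.

Lemma comm1 (A : M) : comm A 1%:M = 0.
Proof. by rewrite /comm mulmx1 mul1mx subrr. Qed.

End HilbertSchmidt.

(** * Functional calculus of self-adjoint matrices *)

Section FunctionalCalculus.
Context {R : realType} {d : nat}.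
Local Notation C := R[i].
Local Notation M := 'M[C]_d.

(** Diagonalization in an arbitrary orthonormal basis, so that the functional
    calculus can be computed away from the chosen [spectralmx]. *)
Definition udiag (U : M) (l : 'I_d -> R) : M :=
  U ^t* *m diag_mx (\row_i (l i)%:C) *m U.

Lemma unitary_mulV (U : M) : U \is unitarymx -> U *m U ^t* = 1%:M.
Proof. by move/unitarymxP. Qed.

Lemma unitary_mulVl (U : M) : U \is unitarymx -> U ^t* *m U = 1%:M.
Proof. by move=> /unitarymxP H; rewrite mulmx1C. Qed.

Lemma udiagE (U : M) (l : 'I_d -> R) :
  udiag U l = \sum_i (l i)%:C *: ((row i U) ^t* *m row i U).
Proof.
apply/matrixP => a b; rewrite summxE mxE; apply: eq_bigr => i _.
by rewrite mul_mx_diag !mxE big_ord1 !mxE mulrAC mulrC.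
Qed.

Lemma mxfunE (f : R -> R) (A : M) :
  mxfun f A = udiag (spectralmx A) (fun i => f (spval A i)).
Proof. by rewrite udiagE. Qed.

Lemma udiag_spec (A : M) : A \is hermsymmx ->
  A = udiag (spectralmx A) (spval A).
Proof. by move=> /spectral_sum {1}->; rewrite udiagE. Qed.

Lemma udiag_dag U l : (udiag U l) ^t* = udiag U l.
Proof.
rewrite /udiag 2!dagM dagK (mulmxA (U ^t*)); congr (_ *m _ *m _).
apply/matrixP => i j; rewrite dagE !mxE eq_sym.
by case: eqP => [->|_]; rewrite ?mulr1n ?mulr0n ?conjc_real ?conjc0.
Qed.

Lemma udiag_herm U l : udiag U l \is hermsymmx.
Proof. exact/hermP/udiag_dag. Qed.

Lemma eq_udiag U l k : l =1 k -> udiag U l = udiag U k.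
Proof. by move=> lk; rewrite !udiagE; apply: eq_bigr => i _; rewrite lk. Qed.

Lemma udiagM U l k : U \is unitarymx ->
  udiag U l *m udiag U k = udiag U (fun i => l i * k i).
Proof.
move=> Uu; rewrite /udiag -!mulmxA (mulmxA U) (unitary_mulV Uu) mul1mx.
rewrite (mulmxA (diag_mx _)) mulmx_diag; congr (_ *m (diag_mx _ *m _)).
by apply/rowP => i; rewrite !mxE rmorphM.
Qed.

Lemma udiag_cst U c : U \is unitarymx -> udiag U (fun=> c) = c%:C%:M.
Proof.
move=> Uu; rewrite /udiag.
have -> : diag_mx (\row__ c%:C) = c%:C%:M :> M.
  by apply/matrixP => i j; rewrite !mxE.
by rewrite -scalemx1 -scalemxAr mulmx1 -scalemxAl unitary_mulVl.
Qed.

Lemma udiagZ U c l : udiag U (fun i => c * l i) = c%:C *: udiag U l.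
Proof.
rewrite !udiagE scaler_sumr; apply: eq_bigr => i _.
by rewrite rmorphM scalerA.
Qed.

Lemma tr_udiag U l : U \is unitarymx -> \tr (udiag U l) = (\sum_i l i)%:C.
Proof.
move=> Uu; rewrite /udiag mxtrace_mulC mulmxA (unitary_mulV Uu) mul1mx mxtrace_diag.
by rewrite rmorph_sum; apply: eq_bigr => i _; rewrite mxE.
Qed.

(** In the eigenbases the hypothesis says that the coefficient [(i, j)] of [X]
    vanishes unless [l i = k j]; this passes to any function of the
    eigenvalues. *)
Lemma udiag_intertwine (f : R -> R) U W l k (X : M) :
  U \is unitarymx -> W \is unitarymx ->
  udiag U l *m X = X *m udiag W k ->
  udiag U (f \o l) *m X = X *m udiag W (f \o k).
Proof.
move=> Uu Wu; set Y := U *m X *m W ^t*.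
have tr (l' k' : 'I_d -> R) : udiag U l' *m X = X *m udiag W k' <->
    forall i j, (l' i)%:C * Y i j = Y i j * (k' j)%:C.
  have -> : udiag U l' *m X = X *m udiag W k' <->
      diag_mx (\row_i (l' i)%:C) *m Y = Y *m diag_mx (\row_i (k' i)%:C).
    rewrite /udiag /Y; split => [H|H].
      have := congr1 (fun Z => U *m Z *m W ^t*) H; rewrite !mulmxA.
      rewrite (unitary_mulV Uu) mul1mx => ->.
      by rewrite -(mulmxA _ W) (unitary_mulV Wu) mulmx1.
    have := congr1 (fun Z => U ^t* *m Z *m W) H; rewrite !mulmxA.
    rewrite (unitary_mulVl Uu) mul1mx => <-.
    by rewrite -(mulmxA _ (W ^t*)) (unitary_mulVl Wu) mulmx1.
  rewrite mul_diag_mx mul_mx_diag; split=> [/matrixP H i j|H].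
    by have := H i j; rewrite !mxE.
  by apply/matrixP => i j; have := H i j; rewrite !mxE.
move=> /tr H; apply/tr => i j /=; have := H i j.
rewrite mulrC; have [->|Y0] := eqVneq (Y i j) 0; first by rewrite !(mul0r, mulr0).
by move=> /(mulfI Y0)/complexI ->; rewrite mulrC.
Qed.

(** Intertwining by the identity matrix: two eigenbases of one matrix define the
    same functional calculus. *)
Lemma mxfun_udiag (f : R -> R) U l : U \is unitarymx ->
  mxfun f (udiag U l) = udiag U (f \o l).
Proof.
move=> Uu; rewrite mxfunE.
have := @udiag_intertwine f (spectralmx (udiag U l)) U
  (spval (udiag U l)) l 1%:M (spectral_unitarymx _) Uu.
by rewrite -udiag_spec ?udiag_herm// !mulmx1 !mul1mx; apply.
Qed.

Lemma mxfun_intertwine (f : R -> R) (A B X : M) :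
  A \is hermsymmx -> B \is hermsymmx ->
  A *m X = X *m B -> mxfun f A *m X = X *m mxfun f B.
Proof.
move=> Ah Bh; rewrite {1}(udiag_spec Ah) {1}(udiag_spec Bh) !mxfunE.
by apply: udiag_intertwine; exact: spectral_unitarymx.
Qed.

Lemma mxfun_herm f (A : M) : mxfun f A \is hermsymmx.
Proof. by rewrite mxfunE udiag_herm. Qed.

Lemma spproj_mul (A : M) i k :
  spproj A i *m spproj A k = if i == k then spproj A i else 0.
Proof.
have := unitary_mulV (spectral_unitarymx A) => /matrixP/(_ i k).
rewrite /spproj mulmxA -(mulmxA _ (row i _)) [_ i k]mxE => H.
have -> : row i (spectralmx A) *m (row k (spectralmx A)) ^t* = (i == k)%:R%:M.
  apply/matrixP => a b; rewrite !ord1 [RHS]mxE eqxx mulr1n.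
  rewrite [(1%:M : M) i k]mxE in H; rewrite -H mxE.
  by apply: eq_bigr => j _; rewrite !mxE.
case: eqP => [->|_]; first by rewrite mulmx1.
by rewrite -scalemx1 scale0r mulmx0 mul0mx.
Qed.

Lemma spproj_mxfunl f (A : M) i :
  spproj A i *m mxfun f A = (f (spval A i))%:C *: spproj A i.
Proof.
rewrite mulmx_sumr (bigD1 i)//= -scalemxAr spproj_mul eqxx big1 ?addr0//.
by move=> k /negbTE ki; rewrite -scalemxAr spproj_mul eq_sym ki scaler0.
Qed.

Lemma spproj_mxfunr f (A : M) i :
  mxfun f A *m spproj A i = (f (spval A i))%:C *: spproj A i.
Proof.
rewrite mulmx_suml (bigD1 i)//= -scalemxAl spproj_mul eqxx big1 ?addr0//.
by move=> k /negbTE ki; rewrite -scalemxAl spproj_mul ki scaler0.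
Qed.

Lemma mxfun_id (A : M) : A \is hermsymmx -> mxfun id A = A.
Proof. by move=> Ah; rewrite mxfunE -udiag_spec. Qed.

Lemma spproj_dag (A : M) i : (spproj A i) ^t* = spproj A i.
Proof. by rewrite /spproj dagM dagK. Qed.

Lemma sum_spproj (A : M) : \sum_i spproj A i = 1%:M.
Proof.
transitivity (udiag (spectralmx A) (fun=> 1)).
  by rewrite udiagE; apply: eq_bigr => i _; rewrite scale1r.
by rewrite udiag_cst ?spectral_unitarymx.
Qed.

Lemma tr_spproj (A : M) i : \tr (spproj A i) = 1.
Proof.
have H : (spectralmx A *m (spectralmx A) ^t*) i i = 1.
  by rewrite (unitary_mulV (spectral_unitarymx A)) mxE eqxx.
rewrite -H /spproj mxtrace_mulC /mxtrace big_ord1 !mxE.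
by apply: eq_bigr => j _; rewrite !mxE.
Qed.

End FunctionalCalculus.

(** * Positive definite matrices and their powers *)

Section PositiveDefinite.
Context {R : realType} {d : nat}.
Local Notation C := R[i].
Local Notation M := 'M[C]_d.

Definition posdef (A : M) := A \is hermsymmx /\ forall i, 0 < spval A i.

(** Rayleigh quotient: this is how positivity of the quadratic form reaches the
    eigenvalues. *)
Lemma spval_form (A : M) i : A \is hermsymmx ->
  (spval A i)%:C = (row i (spectralmx A) *m A *m (row i (spectralmx A)) ^t*) 0 0.
Proof.
move=> Ah; set u := row i _.
have -> : (u *m A *m u ^t*) 0 0 = \tr (u *m A *m u ^t*).
  by rewrite /mxtrace big_ord1.
rewrite mxtrace_mulC mulmxA -[_ *m u]/(spproj A i) -[X in _ *m X](mxfun_id Ah).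
by rewrite spproj_mxfunl linearZ /= tr_spproj mulr1.
Qed.

Lemma psdmx_spval_ge0 (A : M) i : psdmx A -> 0 <= spval A i.
Proof.
move=> [Ah /(_ ((row i (spectralmx A)) ^t*))].
by rewrite dagK -spval_form// lecR.
Qed.

Lemma form_udiag (U : M) (l : 'I_d -> R) (v : 'cV[C]_d) :
  (v ^t* *m udiag U l *m v) 0 0 = \sum_i (l i)%:C * `|(U *m v) i 0| ^+ 2.
Proof.
rewrite /udiag !mulmxA -(mulmxA _ U v) -dagM mul_mx_diag mxE.
by apply: eq_bigr => i _; rewrite [X in X * _]mxE dagE [(\row__ _) _ _]mxE sqr_normc; ring.
Qed.

Lemma udiag_unit (U : M) (l : 'I_d -> R) : U \is unitarymx -> (forall i, l i != 0) ->
  udiag U l \in unitmx.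
Proof.
move=> Uu l0; apply: (proj1 (@mulmx1_unit _ _ _ (udiag U (fun i => (l i)^-1)) _)).
rewrite udiagM// -[1%:M]/(1%:C%:M) -(udiag_cst _ Uu); apply: eq_udiag => i /=.
by rewrite divff.
Qed.

Lemma posdef_unit A : posdef A -> A \in unitmx.
Proof.
move=> [Ah A0]; rewrite (udiag_spec Ah) udiag_unit ?spectral_unitarymx// => i.
by rewrite gt_eqF.
Qed.

Lemma posdef_psd A : posdef A -> psdmx A.
Proof.
move=> [Ah A0]; split=> // v; rewrite (udiag_spec Ah) form_udiag.
by apply: sumr_ge0 => i _; rewrite mulr_ge0 ?exprn_ge0// lecR ltW.
Qed.

Lemma posdefP A : posdef A <-> psdmx A /\ \rank A = d.
Proof.
split=> [Ap|[Ap rA]].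
  by split; [exact: posdef_psd|apply: mxrank_unit; exact: posdef_unit].
have Ah : A \is hermsymmx by case: Ap.
split=> // i; rewrite lt_neqAle psdmx_spval_ge0// andbT eq_sym; apply/eqP => s0.
have Au : A \in unitmx by rewrite -row_free_unit /row_free rA.
have := spproj_mxfunl id A i; rewrite mxfun_id// s0 scale0r.
move/(congr1 (fun Z => \tr (Z *m invmx A))).
by rewrite mulmxK// mul0mx tr_spproj raddf0; apply/eqP; rewrite oner_eq0.
Qed.

Lemma posdef_congr (A S : M) : S \in unitmx -> posdef A -> posdef (S ^t* *m A *m S).
Proof.
move=> Su Ap; apply/posdefP; split; last first.
  apply: mxrank_unit; rewrite !unitmx_mul Su (posdef_unit Ap) !andbT.
  by rewrite map_unitmx unitmx_tr.
have [Ah A0] := posdef_psd Ap; split=> [|v].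
  by apply/hermP; rewrite !dagM dagK (hermP _ Ah) mulmxA.
by have := A0 (S *m v); rewrite dagM !mulmxA.
Qed.

Lemma udiag_posdef (U : M) (l : 'I_d -> R) : U \is unitarymx -> (forall i, 0 < l i) ->
  posdef (udiag U l).
Proof.
move=> Uu l0; apply/posdefP; split; last first.
  by apply: mxrank_unit; rewrite udiag_unit// => i; rewrite gt_eqF.
split=> [|v]; first exact: udiag_herm.
rewrite form_udiag; apply: sumr_ge0 => i _.
by rewrite mulr_ge0 ?exprn_ge0// lecR ltW.
Qed.

Lemma posdefZ A (a : R) : 0 < a -> posdef A -> posdef (a%:C *: A).
Proof.
move=> a0 [Ah A0]; rewrite (udiag_spec Ah) -udiagZ.
by apply: udiag_posdef => [|i]; rewrite ?spectral_unitarymx// mulr_gt0.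
Qed.

Lemma mxpow_posdef A s : posdef A -> posdef (mxpow A s).
Proof.
move=> [Ah A0]; rewrite /mxpow mxfunE.
by apply: udiag_posdef => [|i]; rewrite ?spectral_unitarymx// powR_gt0.
Qed.

Lemma mxpow_dag (A : M) s : (mxpow A s) ^t* = mxpow A s.
Proof. exact/hermP/mxfun_herm. Qed.

Lemma mxpowD A s t : posdef A -> mxpow A s *m mxpow A t = mxpow A (s + t).
Proof.
move=> [Ah A0]; rewrite /mxpow !mxfunE (udiagM _ _ (spectral_unitarymx A)).
by apply: eq_udiag => i; rewrite powRD//; apply/implyP => _; rewrite gt_eqF.
Qed.

Lemma mxpow0 (A : M) : mxpow A 0 = 1%:M.
Proof.
rewrite /mxpow mxfunE -[1%:M]/(1%:C%:M) -(udiag_cst _ (spectral_unitarymx A)).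
by apply: eq_udiag => i; rewrite powRr0.
Qed.

Lemma mxpow1 A : posdef A -> mxpow A 1 = A.
Proof.
move=> [Ah A0]; rewrite /mxpow mxfunE {3}(udiag_spec Ah).
by apply: eq_udiag => i; rewrite powRr1// ltW.
Qed.

Lemma mxpowNK A s : posdef A -> mxpow A s *m mxpow A (- s) = 1%:M.
Proof. by move=> Ap; rewrite mxpowD// subrr mxpow0. Qed.

Lemma mxpowKN A s : posdef A -> mxpow A (- s) *m mxpow A s = 1%:M.
Proof. by move=> Ap; rewrite mxpowD// addNr mxpow0. Qed.

Lemma mxpowZ A (a s : R) : 0 < a -> posdef A ->
  mxpow (a%:C *: A) s = (a `^ s)%:C *: mxpow A s.
Proof.
move=> a0 [Ah A0]; rewrite {1}(udiag_spec Ah) -udiagZ /mxpow.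
rewrite mxfun_udiag ?spectral_unitarymx// mxfunE -udiagZ.
by apply: eq_udiag => i /=; rewrite powRM// ltW.
Qed.

End PositiveDefinite.

(** * The modular relation and the dual generator *)

Section Modular.
Context {R : realType} {d : nat}.
Local Notation C := R[i].
Local Notation M := 'M[C]_d.

Lemma hsdot_suml (I : finType) (F : I -> M) (Y : M) :
  hsdot (\sum_i F i) Y = \sum_i hsdot (F i) Y.
Proof. by rewrite /hsdot dag_sum mulmx_suml raddf_sum. Qed.

Lemma hsdotNl (X Y : M) : hsdot (- X) Y = - hsdot X Y.
Proof. by rewrite -scaleN1r hsdotZl rmorphN1 mulN1r. Qed.

Lemma hsdot_eq0 (X : M) : hsdot X X = 0 -> X = 0.
Proof.
rewrite hsdot_normE => /complexI /psumr_eq0P H; apply/matrixP => i j.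
have {}H := H (fun i _ => sumr_ge0 _ (fun j _ => addr_ge0 (sqr_ge0 _) (sqr_ge0 _))) i isT.
have /psumr_eq0P {}H := H.
have {}H := H (fun j _ => addr_ge0 (sqr_ge0 _) (sqr_ge0 _)) j isT.
move/eqP: H; rewrite paddr_eq0 ?sqr_ge0// !sqrf_eq0 => /andP[/eqP r0 /eqP i0].
by rewrite mxE [X i j]complexE r0 i0 mulr0 addr0.
Qed.

(** [V] shifts the logarithm of [sigma] by [- w]; equivalently, it intertwines
    [sigma] with [e^(-w) sigma], which is the form that powers preserve. *)
Definition modular (sigma V : M) (w : R) :=
  sigma *m V = (expR (- w))%:C *: (V *m sigma).

Lemma modular_pow (sigma V : M) (w s : R) : posdef sigma -> modular sigma V w ->
  mxpow sigma s *m V = (expR (- (w * s)))%:C *: (V *m mxpow sigma s).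
Proof.
move=> sp sV; have sh : sigma \is hermsymmx by case: sp.
have sV' : sigma *m V = V *m ((expR (- w))%:C *: sigma) by rewrite sV scalemxAr.
have := mxfun_intertwine (fun x => x `^ s) sh _ sV'.
rewrite -!/(mxpow _ s) mxpowZ ?expR_gt0// -expRM mulNr => -> //.
  by rewrite scalemxAr.
by apply/hermP; rewrite dagZr (hermP _ sh).
Qed.

(** One term of the generator, paired with [rho]: moving the jump operator to
    the other side leaves a single commutator with [V]. *)
Lemma hsdot_jump (V X rho : M) (e e' : R) :
  hsdot (e%:C *: (V ^t* *m comm X V) + e'%:C *: (comm V X *m V ^t*)) rho =
  - hsdot (comm V X) (e%:C *: (V *m rho) - e'%:C *: (rho *m V)).
Proof.
have -> : comm X V = - comm V X by rewrite /comm opprB.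
move: (comm V X) => D; have ZL a Z : hsdot (a%:C *: Z) rho = a%:C * hsdot Z rho.
  by rewrite hsdotZl conjc_real.
rewrite hsdotDl (ZL e) (ZL e') hsdotBr 2!(hsdotZr _ D) opprB.
rewrite addrC; congr (_ + _).
  congr (_ * _).
  by rewrite /hsdot dagM dagK -mulmxA mxtrace_mulC mulmxA.
rewrite -mulrN; congr (_ * _).
rewrite mulmxN hsdotNl; congr (- _).
by rewrite /hsdot dagM dagK mulmxA.
Qed.

(** The dual generator is minus the divergence of the flux
    [e^(-w/2) V rho - e^(w/2) rho V], the same shape as the operator defining
    the metric. *)
Lemma superadj_alicki (sigma : M) (L : M -> M) J (V : 'I_J -> M)
    (omega c : 'I_J -> R) (rho : M) :
  alicki_form sigma L V omega c ->
  superadj L rho = - \sum_j comm ((V j) ^t*)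
    ((expR (- omega j / 2))%:C *: (V j *m rho)
     - (expR (omega j / 2))%:C *: (rho *m V j)).
Proof.
move=> /alicki_gen LE; apply: superadj_unique => X.
rewrite LE hsdot_suml -scaleN1r hsdotZr hsdot_sumr mulr_sumr.
apply: eq_bigr => j _.
by rewrite -superadj_comm -hsdot_superadj mulN1r hsdot_jump.
Qed.

End Modular.

Section Gamma.
Context {R : realType} {d : nat}.
Local Notation C := R[i].
Local Notation M := 'M[C]_d.
Variable sigma : M.
Hypothesis sigma_pos : posdef sigma.
Local Notation G := (Gamma sigma).

Lemma Gamma_is_linear s : linear (G s).
Proof.
by move=> a X Y; rewrite /Gamma mulmxDr mulmxDl -scalemxAr -scalemxAl.
Qed.

HB.instance Definition _ s :=
  GRing.isLinear.Build C M M *:%R (G s) (Gamma_is_linear s).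

Lemma GammaZ s a (X : M) : G s (a *: X) = a *: G s X.
Proof. exact: linearZ. Qed.

Lemma GammaB s (X Y : M) : G s (X - Y) = G s X - G s Y.
Proof. exact: linearB. Qed.

Lemma Gamma_dag s (X : M) : (G s X) ^t* = G s (X ^t*).
Proof. by rewrite /Gamma !dagM !mxpow_dag mulmxA. Qed.

Lemma GammaD s t (X : M) : G s (G t X) = G (s + t) X.
Proof.
have := mxpowD (s / 2) (t / 2) sigma_pos; have := mxpowD (t / 2) (s / 2) sigma_pos.
rewrite /Gamma mulrDl [t / 2 + _]addrC.
move: (mxpow sigma (s / 2 + t / 2)) (mxpow sigma (s / 2)) (mxpow sigma (t / 2)) => U S T TS ST.
by rewrite !mulmxA ST -mulmxA TS.
Qed.

Lemma GammaK s (X : M) : G s (G (- s) X) = X.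
Proof.
by rewrite GammaD subrr /Gamma mul0r mxpow0 mulmx1 mul1mx.
Qed.

Lemma GammaNK s (X : M) : G (- s) (G s X) = X.
Proof. by rewrite -{2}[s]opprK GammaK. Qed.

Lemma Gamma_posdef s (X : M) : posdef X -> posdef (G s X).
Proof.
move=> Xp; rewrite /Gamma -{1}mxpow_dag; apply: posdef_congr => //.
exact/posdef_unit/mxpow_posdef.
Qed.

Lemma hsdot_Gamma s (X Y : M) : hsdot (G s X) Y = hsdot X (G s Y).
Proof.
rewrite /hsdot Gamma_dag /Gamma; move: (mxpow _ _) (X ^t*) => S Z.
by rewrite -!mulmxA mxtrace_mulC !mulmxA.
Qed.

(** Conjugating by powers of [sigma] moves them past [V] at the cost of half of
    the modular weight on each side. *)
Lemma Gamma_modl s (V Z : M) w : modular sigma V w ->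
  G s (V *m G (- s) Z) = (expR (- (w * (s / 2))))%:C *: (V *m Z).
Proof.
move=> sV; have := modular_pow (s / 2) sigma_pos sV.
have := mxpowNK (s / 2) sigma_pos; have := mxpowKN (s / 2) sigma_pos.
rewrite /Gamma mulNr; move: (mxpow _ (s / 2)) (mxpow _ (- (s / 2))).
move=> S T TS ST SV; rewrite -!mulmxA TS mulmx1 (mulmxA S V) SV.
by rewrite -scalemxAl -mulmxA (mulmxA S T) ST mul1mx.
Qed.

Lemma Gamma_modr s (V Z : M) w : modular sigma V w ->
  G s (G (- s) Z *m V) = (expR (w * (s / 2)))%:C *: (Z *m V).
Proof.
move=> sV; have := modular_pow (- (s / 2)) sigma_pos sV.
have := mxpowNK (s / 2) sigma_pos; have := mxpowKN (s / 2) sigma_pos.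
rewrite /Gamma mulNr mulrN opprK; move: (mxpow _ (s / 2)) (mxpow _ (- (s / 2))).
move=> S T TS ST TV; rewrite -!mulmxA (mulmxA T V) TV.
rewrite -scalemxAl -!scalemxAr -mulmxA TS mulmx1.
by rewrite (mulmxA S T) ST mul1mx.
Qed.

End Gamma.

(** * Double operator sums *)

Section DoubleOperatorSum.
Context {R : realType} {d : nat}.
Local Notation C := R[i].
Local Notation M := 'M[C]_d.

Lemma mxfun2_is_linear f (A B : M) : linear (mxfun2 f A B).
Proof.
move=> a X Y; rewrite /mxfun2 scaler_sumr -big_split; apply: eq_bigr => i _ /=.
rewrite scaler_sumr -big_split; apply: eq_bigr => k _ /=.
rewrite mulmxDr mulmxDl -scalemxAr -scalemxAl scalerDr !scalerA.
by rewrite [a * _]mulrC.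
Qed.

HB.instance Definition _ f (A B : M) :=
  GRing.isLinear.Build C M M *:%R (mxfun2 f A B) (mxfun2_is_linear f A B).

Lemma spproj_resolution (A B X : M) :
  \sum_i \sum_k spproj A i *m X *m spproj B k = X.
Proof.
under eq_bigr do rewrite -mulmx_sumr sum_spproj mulmx1.
by rewrite -mulmx_suml sum_spproj mul1mx.
Qed.

Lemma spproj_diff g (A B X : M) i k :
  spproj A i *m (X *m mxfun g B - mxfun g A *m X) *m spproj B k =
  (g (spval B k) - g (spval A i))%:C *: (spproj A i *m X *m spproj B k).
Proof.
rewrite mulmxBr mulmxBl rmorphB scalerBl; congr (_ - _).
  by rewrite -!mulmxA spproj_mxfunr -!scalemxAr.
by rewrite !mulmxA spproj_mxfunl -!scalemxAl.
Qed.

(** Applied to a difference [X g(B) - g(A) X], a double operator sum acts as a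
    Schur multiplier on the divided differences: it exchanges [g] for [h]
    whenever [f] is the ratio of their increments. *)
Lemma mxfun2_diff f g h (A B X : M) :
  (forall i k, f (spval A i) (spval B k) * (g (spval B k) - g (spval A i)) =
     h (spval B k) - h (spval A i)) ->
  mxfun2 f A B (X *m mxfun g B - mxfun g A *m X) =
  X *m mxfun h B - mxfun h A *m X.
Proof.
move=> fgh; rewrite -[RHS](spproj_resolution A B) /mxfun2.
apply: eq_bigr => i _; apply: eq_bigr => k _.
by rewrite [in LHS]spproj_diff [in RHS]spproj_diff scalerA -rmorphM fgh.
Qed.

Lemma dagM3 (A B D : M) : (A *m B *m D) ^t* = D ^t* *m B ^t* *m A ^t*.
Proof. by rewrite dagM dagM mulmxA. Qed.

Lemma mxfun2_dag f (A B X : M) :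
  (mxfun2 f A B X) ^t* = mxfun2 (fun x y => f y x) B A (X ^t*).
Proof.
rewrite /mxfun2 dag_sum [RHS]exchange_big; apply: eq_bigr => i _ /=.
rewrite dag_sum; apply: eq_bigr => k _.
by rewrite dagZr dagM3 !spproj_dag.
Qed.

Lemma spproj_idem (A : M) i : spproj A i *m spproj A i = spproj A i.
Proof. by rewrite spproj_mul eqxx. Qed.

Lemma hsdot_mxfun2 f (A B Z : M) :
  hsdot Z (mxfun2 f A B Z) =
  \sum_i \sum_k (f (spval A i) (spval B k))%:C *
     hsdot (spproj A i *m Z *m spproj B k) (spproj A i *m Z *m spproj B k).
Proof.
rewrite hsdot_sumr; apply: eq_bigr => i _; rewrite hsdot_sumr.
apply: eq_bigr => k _; rewrite hsdotZr; congr (_ * _).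
rewrite /hsdot dagM3 !spproj_dag.
have := spproj_idem A i; have := spproj_idem B k.
move: (spproj A i) (spproj B k) => P Q QQ PP.
by rewrite -!mulmxA [RHS]mxtrace_mulC -!mulmxA QQ (mulmxA P P) PP.
Qed.

(** In the eigenbases a double operator sum multiplies the matrix coefficients
    by positive numbers. *)
Lemma mxfun2_definite f (A B Z : M) :
  (forall i k, 0 < f (spval A i) (spval B k)) ->
  0 <= hsdot Z (mxfun2 f A B Z) /\ (hsdot Z (mxfun2 f A B Z) = 0 -> Z = 0).
Proof.
move=> f0; rewrite hsdot_mxfun2.
have F0 i k : 0 <= (f (spval A i) (spval B k))%:C *
     hsdot (spproj A i *m Z *m spproj B k) (spproj A i *m Z *m spproj B k).
  by rewrite mulr_ge0 ?hsdot_ge0// lecR ltW.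
split=> [|H]; first by do 2! apply: sumr_ge0 => ? _.
rewrite -(spproj_resolution A B Z) big1// => i _; rewrite big1// => k _.
apply: hsdot_eq0.
have /psumr_eq0P H1 := H.
have {H1}/psumr_eq0P H1 := H1 (fun i _ => sumr_ge0 _ (fun k _ => F0 i k)) i isT.
have /eqP := H1 (fun k _ => F0 i k) k isT.
by rewrite mulf_eq0 => /orP[/eqP/complexI f00|/eqP//]; have := f0 i k; rewrite f00 ltxx.
Qed.

End DoubleOperatorSum.

(** * The kernel theta and scalar inequalities for powers *)

Section Scalar.
Context {R : realType}.
Implicit Types (p u x y s : R).

(** Weighted arithmetic-geometric mean inequality, from the tangent line of the
    exponential at the weighted mean [s * ln u] of the two exponents. *)
Lemma powR_le_lin s u : 0 <= s <= 1 -> 0 <= u -> u `^ s <= 1 - s + s * u.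
Proof.
move=> /andP[s0 s1]; rewrite le0r => /orP[/eqP ->|u0].
  have [->|sn0] := eqVneq s 0; first by rewrite powRr0 mul0r; lra.
  by rewrite powR0// mulr0; lra.
pose l := ln u; have -> : u `^ s = expR (s * l) by rewrite /powR gt_eqF.
have tangent (t : R) : expR (s * l) * (1 + (t - s * l)) <= expR t.
  rewrite -{2}[t](subrK (s * l)) [_ + s * l]addrC expRD ler_pM2l ?expR_gt0//.
  exact: expR_ge1Dx.
have := tangent 0; have := tangent l; rewrite lnK// expR0.
move=> /(ler_wpM2l s0) H1; have s1' : 0 <= 1 - s by lra.
move=> /(ler_wpM2l s1') H2; have := lerD H1 H2.
set e := expR _ => H; apply: le_trans (_ : s * u + (1 - s) * 1 <= _); last lra.
by apply: le_trans H; rewrite le_eqVlt; apply/orP; left; apply/eqP; ring.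
Qed.

(** Both bounds are tangency at [u = 1]. They hold for negative [u] too, which
    makes the expansion of the trace of a power insensitive to the sign of the
    eigenvalues of the perturbed matrix. *)
Lemma powR_tangent p u : 1 < p <= 2 ->
  0 <= `|u| `^ p - 1 - p * (u - 1) <= (u - 1) ^+ 2.
Proof.
move=> /andP[p1 p2].
have lin (v : R) : 0 <= v -> p * v <= p - 1 + v `^ p.
  move=> v0; have pV : 0 <= p^-1 <= 1 by rewrite invr_ge0 ltW ?invf_le1; lra.
  have := powR_le_lin pV (powR_ge0 v p).
  rewrite -powRrM divff ?gt_eqF ?powRr1//; last lra.
  move=> /(ler_wpM2l (_ : 0 <= p)) H; have := H _; rewrite mulrDr mulrBr mulr1.
  by rewrite mulrA divff ?gt_eqF ?mul1r; lra.
have quad (v : R) : 0 <= v -> v `^ p <= (2 - p) * v + (p - 1) * v ^+ 2.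
  move=> v0; rewrite -mulr_powRB1//; last lra.
  have p01 : 0 <= p - 1 <= 1 by lra.
  by have := ler_wpM2l v0 (powR_le_lin p01 v0); nra.
have a0 := normr_ge0 u; have := powR_ge0 `|u| p.
have := lin _ a0; have := quad _ a0; move: (_ `^ p) => z.
have q0 := sqr_ge0 (u - 1); have r0 : 0 <= (2 - p) * (u - 1) ^+ 2 by rewrite mulr_ge0//; lra.
have r1 : 0 <= (2 - p) * u ^+ 2 by rewrite mulr_ge0 ?sqr_ge0//; lra.
have [u0|u0] := leP 0 u; [rewrite ger0_norm//|rewrite ltr0_norm//] => H1 H2 z0.
  by apply/andP; split; nra.
by apply/andP; split; nra.
Qed.

Variable p : R.
Hypothesis p12 : 1 < p <= 2.
Let p1 : 0 < p - 1. Proof. by move: p12 => /andP[]; rewrite subr_gt0. Qed.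

Lemma theta_sym x y : theta p x y = theta p y x.
Proof.
rewrite /theta [y == x]eq_sym; case: eqP => [->//|_].
rewrite -[x - y]opprB -[x `^ _ - _]opprB invrN.
by rewrite mulrNN.
Qed.

Lemma theta_gt0 x y : 0 < x -> 0 < y -> 0 < theta p x y.
Proof.
wlog : x y / x <= y => [wl x0 y0|].
  by have [xy|/ltW yx] := leP x y; [exact: wl|rewrite theta_sym wl].
rewrite le_eqVlt /theta => /orP[/eqP ->|xy] x0 y0; first by rewrite eqxx powR_gt0.
rewrite lt_eqF// mulr_gt0// -[x - y]opprB -[x `^ _ - _]opprB invrN mulrNN divr_gt0 ?subr_gt0//.
by rewrite gt0_ltr_powR// nnegrE ltW.
Qed.

(** [theta] is the inverse of the divided difference of the power [p - 1], up
    to the factor [p - 1]. *)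
Lemma theta_diff x y : 0 < x -> 0 < y ->
  theta p x y * (y `^ (p - 1) - x `^ (p - 1)) = (p - 1) * y - (p - 1) * x.
Proof.
move=> x0 y0; rewrite /theta; case: eqP => [->|/eqP xy]; first by rewrite !subrr mulr0.
have D0 : x `^ (p - 1) - y `^ (p - 1) != 0.
  rewrite subr_eq0; apply: contra xy => /eqP H.
  by apply/eqP; apply: (powR_injective p1) H; rewrite nnegrE ltW.
rewrite -[y `^ _ - _]opprB mulrN -!mulrA mulVf// mulr1 -mulrN opprB.
by rewrite mulrBr.
Qed.

End Scalar.

(** * The multiplication operators and the operator of the metric *)

Section MultiplicationOperator.
Context {R : realType} {d : nat}.
Local Notation C := R[i].
Local Notation M := 'M[C]_d.
Variables (p : R) (sigma : M).
Hypothesis p12 : 1 < p <= 2.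
Hypothesis sigma_pos : posdef sigma.
Local Notation G := (Gamma sigma).
Local Notation q := (hatp p)^-1.

Lemma hatpV : q = (p - 1) / p.
Proof. by rewrite /hatp invf_div. Qed.

Lemma mult_op_is_linear rho w : linear (mult_op p sigma rho w).
Proof.
move=> a X Y; rewrite /mult_op; move: (_ *: _ rho) (_ *: _ rho) => A B.
rewrite (Gamma_is_linear sigma q a X Y) (mxfun2_is_linear (theta p) _ _ a).
exact: Gamma_is_linear.
Qed.

HB.instance Definition _ rho w :=
  GRing.isLinear.Build C M M *:%R (mult_op p sigma rho w) (mult_op_is_linear rho w).

Lemma mult_op_dag rho w X :
  (mult_op p sigma rho w X) ^t* = mult_op p sigma rho (- w) (X ^t*).
Proof.
rewrite /mult_op [- - w]opprK.
move: (_ *: G _ rho) (_ *: G _ rho) => A B.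
rewrite Gamma_dag; congr (G q _).
rewrite mxfun2_dag Gamma_dag; congr (mxfun2 _ A B _).
by apply/funext => x; apply/funext => y; rewrite theta_sym.
Qed.

Lemma mult_op_definite rho w X : posdef rho ->
  0 <= hsdot X (mult_op p sigma rho w X) /\
  (hsdot X (mult_op p sigma rho w X) = 0 -> X = 0).
Proof.
move=> rp; have Yp := Gamma_posdef sigma_pos (- q) rp.
rewrite /mult_op -hsdot_Gamma.
set A := _ *: G _ _; set B := _ *: G _ _.
have [|P0 Pd] := @mxfun2_definite _ _ (theta p) A B (G q X).
  by move=> i k; rewrite theta_gt0//;
    [have [_] : posdef A := posdefZ (expR_gt0 _) Yp
    |have [_] : posdef B := posdefZ (expR_gt0 _) Yp]; apply.
split=> // /Pd H; rewrite -(GammaNK sigma_pos q X) H.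
by rewrite linear0.
Qed.

(** The derivative of the divergence, represented in the Hilbert-Schmidt
    product. *)
Definition div_potential (rho : M) : M :=
  ((p - 1)^-1)%:C *: G (- q) (mxpow (G (- q) rho) (p - 1)).

(** Noncommutative chain rule. With [Y] the weighted density, the commutator with
    [V] of the potential is, up to the weights, a difference of the powers
    [p - 1] of [e^(w/2p) Y] and [e^(-w/2p) Y]; the kernel [theta] replaces these
    powers by [Y] itself, and the weights combine to [e^(-w/2)] and [e^(w/2)]
    because [1/p + 1/p' = 1] for the conjugate exponent [p']. *)
Lemma mult_op_comm_potential rho V w : posdef rho -> modular sigma V w ->
  mult_op p sigma rho w (comm V (div_potential rho)) =
  (expR (- w / 2))%:C *: (V *m rho) - (expR (w / 2))%:C *: (rho *m V).
Proof.
move=> rp sV; have /andP[p1 p2] := p12.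
have Yp := Gamma_posdef sigma_pos (- q) rp.
rewrite /mult_op /div_potential.
set Y := G (- q) rho in Yp *; set a := w / (2 * p).
have -> : - w / (2 * p) = - a by rewrite mulNr.
have Ap := posdefZ (expR_gt0 a) Yp; have Bp := posdefZ (expR_gt0 (- a)) Yp.
set A := _ *: Y in Ap *; set B := _ *: Y in Bp *.
have aq : w * (q / 2) = a * (p - 1).
  by rewrite hatpV /a; field; rewrite gt_eqF//; lra.
have -> : G q (comm V (((p - 1)^-1)%:C *: G (- q) (mxpow Y (p - 1)))) =
    ((p - 1)^-1)%:C *: (V *m mxpow B (p - 1) - mxpow A (p - 1) *m V).
  rewrite !linearZ /=; congr (_ *: _); rewrite linearB /=.
  rewrite (Gamma_modl sigma_pos q _ sV) (Gamma_modr sigma_pos q _ sV) aq.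
  rewrite /A /B (mxpowZ _ (expR_gt0 a) Yp) (mxpowZ _ (expR_gt0 (- a)) Yp).
  rewrite -2!expRM mulNr; move: (mxpow Y _) => Z.
  by rewrite -scalemxAr -scalemxAl.
rewrite linearZ /= (mxfun2_diff (h := fun x => (p - 1) * x)); last first.
  by move=> i k; rewrite theta_diff//; [case: Ap|case: Bp] => _; apply.
have lin (Z : M) : posdef Z -> mxfun (fun x => (p - 1) * x) Z = (p - 1)%:C *: Z.
  by case=> Zh _; rewrite mxfunE udiagZ -udiag_spec.
rewrite !lin// -scalemxAr -scalemxAl -scalerBr scalerA -rmorphM /=.
rewrite mulVf ?gt_eqF ?subr_gt0// scale1r GammaB /A /B.
rewrite -scalemxAr -scalemxAl 2!GammaZ.
rewrite (Gamma_modl sigma_pos q _ sV) (Gamma_modr sigma_pos q _ sV) aq.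
rewrite 2!scalerA -2!rmorphM -2!expRD.
have -> : - a + - (a * (p - 1)) = - w / 2.
  by rewrite /a; field; rewrite gt_eqF//; lra.
have -> // : a + a * (p - 1) = w / 2.
by rewrite /a; field; rewrite gt_eqF//; lra.
Qed.

End MultiplicationOperator.

Lemma linear_inj_surj (F : fieldType) (m n : nat)
    (T : {linear 'M[F]_(m, n) -> 'M[F]_(m, n)}) :
  (forall X, T X = 0 -> X = 0) -> forall Y, exists X, T X = Y.
Proof.
move=> Ti Y; have Tu : lin_mx T \in unitmx.
  rewrite -row_free_unit; apply: inj_row_free => v; rewrite mul_rV_lin.
  move=> /eqP; rewrite mxvec_eq0 => /eqP/Ti/eqP.
  by rewrite vec_mx_eq0 => /eqP.
exists (vec_mx (mxvec Y *m invmx (lin_mx T))); apply: (can_inj mxvecK).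
by rewrite -mul_vec_lin vec_mxK mulmxKV.
Qed.

Section MetricOperator.
Context {R : realType} {d : nat}.
Local Notation C := R[i].
Local Notation M := 'M[C]_d.
Variables (p : R) (sigma : M) (L : M -> M) (J : nat) (V : 'I_J -> M).
Variables (omega c : 'I_J -> R).
Hypothesis p12 : 1 < p <= 2.
Hypothesis sigma_pos : posdef sigma.
Hypothesis LV : alicki_form sigma L V omega c.
Local Notation D := (Dop p sigma V omega).
Local Notation m_op := (mult_op p sigma).

Lemma alicki_modularE j : modular sigma (V j) (omega j).
Proof.
have := alicki_modular LV j => /(congr1 (fun Z => Z *m sigma)).
by rewrite mulmxKV ?posdef_unit// -scalemxAl.
Qed.

(** Orthogonality makes [j |-> j'] injective, so sums over the jump operators
    can be reindexed along the adjoint. *)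
Lemma alicki_adjoint_inj : exists2 g : 'I_J -> 'I_J, injective g &
  forall j, (V j) ^t* = V (g j) /\ omega (g j) = - omega j.
Proof.
have [g gP] := fin_all_exists (alicki_adjoint LV); exists g => // j k gjk.
have Vjk : V j = V k.
  by rewrite -[V j]dagK -[V k]dagK (gP j).1 (gP k).1 gjk.
apply/eqP; apply/negPn/negP => /negbTE jk.
have := alicki_orthogonal LV j k; rewrite jk -Vjk (alicki_orthogonal LV j j) eqxx.
by move=> /complexI cj; have := alicki_pos LV j; rewrite cj ltxx.
Qed.

Lemma DopE rho A : D rho A =
  \sum_j comm ((V j) ^t*) (m_op rho (omega j) (comm (V j) A)).
Proof. by apply: eq_bigr => j _; rewrite superadj_comm. Qed.

Lemma Dop_is_linear rho : linear (D rho).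
Proof.
move=> a A B; rewrite /Dop scaler_sumr -big_split; apply: eq_bigr => j _ /=.
by rewrite (comm_is_linear (V j) a A B) mult_op_is_linear superadj_is_linear.
Qed.

HB.instance Definition _ rho :=
  GRing.isLinear.Build C M M *:%R (D rho) (Dop_is_linear rho).

Lemma Dop1 rho : D rho 1%:M = 0.
Proof. by rewrite DopE big1// => j _; rewrite comm1 !linear0. Qed.

Lemma tr_Dop rho A : \tr (D rho A) = 0.
Proof. by rewrite DopE raddf_sum big1//= => j _; rewrite tr_comm. Qed.

(** The adjoint exchanges the term of [j] with that of its adjoint partner, since
    [theta] is symmetric and the two weights are opposite. *)
Lemma Dop_dag rho A : (D rho A) ^t* = D rho (A ^t*).
Proof.
have [g gi gP] := alicki_adjoint_inj.
rewrite !DopE dag_sum [RHS](reindex_inj gi); apply: eq_bigr => j _ /=.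
have [VE oE] := gP j.
rewrite comm_dag mult_op_dag comm_dag -VE oE dagK.
by rewrite !linearN opprK.
Qed.

(** The quadratic form of [D] is a sum over [j] of definite forms evaluated at the
    commutators. *)
Lemma Dop_kernel rho A j : posdef rho -> D rho A = 0 -> comm (V j) A = 0.
Proof.
move=> rp /(congr1 (hsdot A)); rewrite hsdot0r hsdot_sumr.
under eq_bigr do rewrite -hsdot_superadj.
move=> /psumr_eq0P H; apply: (mult_op_definite p12 sigma_pos (omega j) _ rp).2.
by apply: H => // k _; apply: (mult_op_definite p12 sigma_pos (omega k) _ rp).1.
Qed.

(** The chain rule, summed over the jump operators. *)
Lemma Dop_potential rho : posdef rho ->
  D rho (div_potential p sigma rho) = - superadj L rho.
Proof.
move=> rp; rewrite (superadj_alicki _ LV) opprK DopE; apply: eq_bigr => j _.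
by rewrite mult_op_comm_potential//; exact: alicki_modularE.
Qed.

Lemma Dop_inj rho A : (0 < d)%N -> posdef rho ->
  (forall B : M, (forall j, comm (V j) B = 0) -> exists a, B = a%:M) ->
  \tr A = 0 -> D rho A = 0 -> A = 0.
Proof.
move=> d0 rp irr A0 DA; have [a Aa] := irr A (fun j => Dop_kernel j rp DA).
move: A0; rewrite Aa mxtrace_scalar => /eqP.
rewrite -mulr_natr mulf_eq0 pnatr_eq0 -[d == _]negbK -lt0n d0 orbF => /eqP ->.
by rewrite raddf0.
Qed.

Definition bordered_Dop rho (A : M) : M := D rho A + \tr A *: 1%:M.

Lemma bordered_Dop_is_linear rho : linear (bordered_Dop rho).
Proof.
move=> a A B; rewrite /bordered_Dop (Dop_is_linear rho a A B) mxtraceD mxtraceZ.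
by rewrite scalerDl -scalerA [in RHS]scalerDr addrACA.
Qed.

HB.instance Definition _ rho :=
  GRing.isLinear.Build C M M *:%R (bordered_Dop rho) (bordered_Dop_is_linear rho).

(** [D] annihilates the identity and has traceless range. Adding the trace
    makes it injective on all matrices as soon as only scalars commute with the
    jump operators, and surjectivity then follows by counting dimensions. *)
Lemma Dop_bij rho : (0 < d)%N -> posdef rho ->
  (forall A : M, (forall j, comm (V j) A = 0) -> exists a, A = a%:M) ->
  forall nu, tangent nu -> exists A, tangent A /\ D rho A = nu.
Proof.
move=> d0 rp irr nu [nuh nu0].
have d0C : (d%:R : C) != 0 by rewrite pnatr_eq0 -lt0n.
have tr0 A : \tr (bordered_Dop rho A) = 0 -> \tr A = 0.
  rewrite /bordered_Dop mxtraceD tr_Dop add0r mxtraceZ mxtrace1 => /eqP.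
  by rewrite mulf_eq0 (negbTE d0C) orbF => /eqP.
have inj A : bordered_Dop rho A = 0 -> A = 0.
  move=> DA; have A0 : \tr A = 0 by apply: tr0; rewrite DA linear0.
  move: DA; rewrite /bordered_Dop A0 scale0r addr0 => DA.
  exact: Dop_inj irr A0 DA.
have [A DA] := linear_inj_surj inj nu.
have A0 : \tr A = 0 by apply: tr0; rewrite DA.
have DA' : D rho A = nu by have := DA; rewrite /= /bordered_Dop A0 scale0r addr0.
exists A; split; last exact: DA'.
split; last exact: A0.
apply/hermP/eqP; rewrite -subr_eq0; apply/eqP/inj.
have DA'' : bordered_Dop rho (A ^t*) = nu.
  by rewrite /bordered_Dop -Dop_dag DA' tr_dag A0 conjc0 scale0r addr0 (hermP _ nuh).
by rewrite linearB; apply/eqP; rewrite subr_eq0 DA; apply/eqP.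
Qed.

End MetricOperator.

(** * First variation of the divergence *)

Section TracePower.
Context {R : realType} {d : nat}.
Local Notation C := R[i].
Local Notation M := 'M[C]_d.
Implicit Types (A B : M) (f g : R -> R).

(** The squared modulus of the inner product of two eigenvectors: for fixed [A]
    and [B] these numbers form a doubly stochastic matrix. *)
Definition overlap A B i k : R := complex.Re (\tr (spproj A i *m spproj B k)).

Lemma tr_hsdot_spproj A B i k : \tr (spproj A i *m spproj B k) =
  hsdot (spproj A i *m spproj B k) (spproj A i *m spproj B k).
Proof.
rewrite /hsdot dagM !spproj_dag.
have := spproj_idem A i; have := spproj_idem B k.
move: (spproj A i) (spproj B k) => P Q QQ PP.
by rewrite -mulmxA (mulmxA P P) PP [RHS]mxtrace_mulC -mulmxA QQ.
Qed.

Lemma overlapE A B i k : (overlap A B i k)%:C = \tr (spproj A i *m spproj B k).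
Proof.
by rewrite /overlap tr_hsdot_spproj RRe_real// ger0_real// hsdot_ge0.
Qed.

Lemma overlap_ge0 A B i k : 0 <= overlap A B i k.
Proof. by rewrite -lecR overlapE tr_hsdot_spproj hsdot_ge0. Qed.

Lemma tr_mxfunM f g A B : \tr (mxfun f A *m mxfun g B) =
  (\sum_i \sum_k overlap A B i k * (f (spval A i) * g (spval B k)))%:C.
Proof.
rewrite /mxfun mulmx_suml raddf_sum rmorph_sum; apply: eq_bigr => i _ /=.
rewrite mulmx_sumr raddf_sum rmorph_sum; apply: eq_bigr => k _ /=.
by rewrite -scalemxAl -scalemxAr scalerA mxtraceZ rmorphM /= overlapE mulrC rmorphM.
Qed.

Lemma mxfun_cst1 A : mxfun (fun=> 1) A = 1%:M.
Proof. by rewrite mxfunE udiag_cst ?spectral_unitarymx. Qed.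

Lemma mxfunM f g A : mxfun f A *m mxfun g A = mxfun (fun x => f x * g x) A.
Proof. by rewrite !mxfunE udiagM ?spectral_unitarymx. Qed.

Lemma sum_spval_overlap f A B :
  \sum_i f (spval A i) = \sum_i \sum_k overlap A B i k * f (spval A i).
Proof.
apply: complexI; transitivity (\tr (mxfun f A *m mxfun (fun=> 1) B)).
  by rewrite mxfun_cst1 mulmx1 mxfunE tr_udiag// spectral_unitarymx.
rewrite tr_mxfunM; congr (_%:C); apply: eq_bigr => i _; apply: eq_bigr => k _.
by rewrite mulr1.
Qed.

Lemma sum_spval_overlapr f A B :
  \sum_k f (spval B k) = \sum_i \sum_k overlap A B i k * f (spval B k).
Proof.
apply: complexI; transitivity (\tr (mxfun (fun=> 1) A *m mxfun f B)).
  by rewrite mxfun_cst1 mul1mx mxfunE tr_udiag// spectral_unitarymx.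
rewrite tr_mxfunM; congr (_%:C); apply: eq_bigr => i _; apply: eq_bigr => k _.
by rewrite mul1r.
Qed.

Lemma tr_mxfun f A : \tr (mxfun f A) = (\sum_i f (spval A i))%:C.
Proof. by rewrite mxfunE tr_udiag// spectral_unitarymx. Qed.

Lemma tr_mxfun_diff f A B : A \is hermsymmx -> B \is hermsymmx ->
  \tr (mxfun f A *m (B - A)) =
  (\sum_i \sum_k overlap A B i k * (f (spval A i) * (spval B k - spval A i)))%:C.
Proof.
move=> Ah Bh; rewrite mulmxBr mxtraceB -{1}(mxfun_id Bh) tr_mxfunM.
have -> : \tr (mxfun f A *m A) = \tr (mxfun (fun x => f x * x) A).
  by rewrite -mxfunM mxfun_id.
rewrite tr_mxfun (sum_spval_overlap (fun x => f x * x) A B) -rmorphB /=.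
congr (_%:C); rewrite -sumrB; apply: eq_bigr => i _; rewrite -sumrB.
by apply: eq_bigr => k _; rewrite -mulrBr -mulrBr.
Qed.

Lemma hsdot_diff A B : A \is hermsymmx -> B \is hermsymmx ->
  hsdot (B - A) (B - A) =
  (\sum_i \sum_k overlap A B i k * (spval B k - spval A i) ^+ 2)%:C.
Proof.
move=> Ah Bh; rewrite /hsdot dagB (hermP _ Ah) (hermP _ Bh).
rewrite mulmxBl 2!mulmxBr 3!mxtraceB (mxtrace_mulC B A).
have AB : \tr (A *m B) = \tr (mxfun id A *m mxfun id B) by rewrite !mxfun_id.
have AA : \tr (A *m A) = \tr (mxfun (fun x => x * x) A) by rewrite -mxfunM !mxfun_id.
have BB : \tr (B *m B) = \tr (mxfun (fun x => x * x) B) by rewrite -mxfunM !mxfun_id.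
rewrite AB AA BB tr_mxfunM 2!tr_mxfun (sum_spval_overlap (fun x => x * x) A B).
rewrite (sum_spval_overlapr (fun x => x * x) A B) -!rmorphB /=; congr (_%:C).
rewrite -!sumrB; apply: eq_bigr => i _; rewrite -!sumrB.
by apply: eq_bigr => k _; ring.
Qed.

(** The bounds at [u = b / a], scaled by [a ^ p]. *)
Lemma scalar_expansion p (a b : R) : 1 < p <= 2 -> 0 < a ->
  0 <= `|b| `^ p - a `^ p - p * (a `^ (p - 1) * (b - a)) <=
  a `^ (p - 2) * (b - a) ^+ 2.
Proof.
move=> p12 a0; have := powR_tangent (b / a) p12.
have -> : `|b| = a * `|b / a|.
  by rewrite normrM normfV (gtr0_norm a0) mulrCA divff ?mulr1 ?gt_eqF.
rewrite (powRM _ (ltW a0) (normr_ge0 _)).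
have e1 : a `^ (p - 1) = a * a `^ (p - 2).
  rewrite -{2}[a]powRr1 ?ltW// -powRD; last by apply/implyP => _; rewrite gt_eqF.
  by congr (_ `^ _); ring.
have e2 : a `^ p = a * (a * a `^ (p - 2)).
  rewrite -e1 -{2}[a]powRr1 ?ltW// -powRD; last by apply/implyP => _; rewrite gt_eqF.
  by congr (_ `^ _); ring.
rewrite e2 e1; have := powR_gt0 (p - 2) a0; move: (a `^ _) (_ `^ p) => c z c0.
have -> : b = a * (b / a) by rewrite mulrCA divff ?mulr1 ?gt_eqF.
have -> : a * (b / a) / a = b / a by field; rewrite gt_eqF.
move: (b / a) => u /andP[H1 H2].
have k0 : 0 <= a * (a * c) by rewrite !mulr_ge0// ltW.
have := ler_wpM2l k0 H1; have := ler_wpM2l k0 H2.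
have -> : a * (a * c) * z - a * (a * c) - p * (a * c * (a * u - a)) =
  a * (a * c) * (z - 1 - p * (u - 1)) by ring.
have -> : c * (a * u - a) ^+ 2 = a * (a * c) * (u - 1) ^+ 2 by ring.
by rewrite mulr0 => -> ->.
Qed.

Definition trace_power p A : R := \sum_i `|spval A i| `^ p.

(** Expanded over a pair of eigenbases, the second order Taylor remainder of
    the trace of a power is a nonnegative combination of scalar remainders, with
    the squared overlaps as weights. *)
Lemma trace_power_expansion p A B : 1 < p <= 2 -> posdef A -> B \is hermsymmx ->
  `|trace_power p B - trace_power p A
    - p * complex.Re (\tr (mxpow A (p - 1) *m (B - A)))| <=
  (\sum_i (spval A i) `^ (p - 2)) * complex.Re (hsdot (B - A) (B - A)).
Proof.
move=> p12 [Ah A0] Bh.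
rewrite /mxpow tr_mxfun_diff// hsdot_diff//= /trace_power.
rewrite (sum_spval_overlap (fun x => `|x| `^ p) A B).
rewrite (sum_spval_overlapr (fun x => `|x| `^ p) A B).
have -> : \sum_i \sum_k overlap A B i k * `|spval B k| `^ p -
      \sum_i \sum_k overlap A B i k * `|spval A i| `^ p -
    p * (\sum_i \sum_k overlap A B i k *
      (spval A i `^ (p - 1) * (spval B k - spval A i))) =
  \sum_i \sum_k overlap A B i k * (`|spval B k| `^ p - spval A i `^ p -
      p * (spval A i `^ (p - 1) * (spval B k - spval A i))).
  rewrite mulr_sumr -!sumrB; apply: eq_bigr => i _; rewrite mulr_sumr -!sumrB.
  by apply: eq_bigr => k _; rewrite (gtr0_norm (A0 i)); ring.
rewrite ger0_norm; last first.
  apply: sumr_ge0 => i _; apply: sumr_ge0 => k _; rewrite mulr_ge0 ?overlap_ge0//.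
  by have /andP[] := scalar_expansion (spval B k) p12 (A0 i).
rewrite mulr_sumr; apply: ler_sum => i _; rewrite mulr_sumr; apply: ler_sum => k _.
rewrite [leRHS]mulrCA ler_wpM2l ?overlap_ge0//.
have /andP[_ H] := scalar_expansion (spval B k) p12 (A0 i).
apply: le_trans H _; rewrite ler_wpM2r ?sqr_ge0//.
by rewrite (bigD1 i)//= lerDl sumr_ge0// => j _; rewrite powR_ge0.
Qed.

Lemma tr_mxabs_pow p A : A \is hermsymmx ->
  \tr (mxpow (mxabs A) p) = (trace_power p A)%:C.
Proof.
move=> Ah; have Uu := spectral_unitarymx A.
rewrite /mxpow /mxabs (hermP _ Ah) {1 2}(udiag_spec Ah) udiagM//.
rewrite mxfun_udiag// mxfun_udiag// tr_udiag//; congr (_%:C).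
by apply: eq_bigr => i _ /=; rewrite -expr2 sqrtr_sqr.
Qed.

End TracePower.

Lemma Re_realM {R : realType} (a : R) (z : R[i]) :
  complex.Re (a%:C * z) = a * complex.Re z.
Proof. by case: z => x y /=; rewrite mul0r subr0. Qed.

Lemma is_derive_quadratic {R : realType} (g : R -> R) (D K : R) :
  (forall e, `|g e - g 0 - e * D| <= K * e ^+ 2) -> is_derive (0 : R) (1 : R) g D.
Proof.
move=> H.
have K0 : 0 <= K by have := H 1; rewrite expr1n mulr1; exact: le_trans.
have cv : (fun h : R => h^-1 *: ((g \o shift (0 : R)) (h *: (1 : R)) - g 0)) @ (0 : R)^' --> D.
  apply/cvgrPdist_le => /= e e0; near=> h.
  have h0 : h != 0 by near: h; exact: nbhs_dnbhs_neq.
  have -> : D - h^-1 *: (g (h *: 1 + 0) - g 0) = - (h^-1 * (g h - g 0 - h * D)).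
    by rewrite addr0 [h *: 1]mulr1 /GRing.scale /=; field.
  rewrite normrN normrM normfV ler_pdivrMl ?normr_gt0//.
  apply: le_trans (H h) _; rewrite -(real_normK (num_real h)) expr2 mulrCA ler_wpM2l//.
  have : `|h| < e / (K + 1) by near: h; apply: dnbhs0_lt; rewrite divr_gt0// ltr_wpDl.
  rewrite ltr_pdivlMr ?ltr_wpDl// => /ltW; apply: le_trans.
  by rewrite mulrC ler_wpM2l// lerDl.
split; first by apply/cvg_ex; exists D.
exact: cvg_lim.
Unshelve. all: by end_near. Qed.

Section Divergence.
Context {R : realType} {d : nat}.
Local Notation C := R[i].
Local Notation M := 'M[C]_d.
Variables (p : R) (sigma : M).
Hypothesis p12 : 1 < p <= 2.
Hypothesis sigma_pos : posdef sigma.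
Local Notation G := (Gamma sigma).
Local Notation q := (hatp p)^-1.

Lemma Gamma_herm s (X : M) : X \is hermsymmx -> G s X \is hermsymmx.
Proof. by move=> /hermP Xh; apply/hermP; rewrite Gamma_dag Xh. Qed.

(** The two powers of [sigma] in the definition of the divergence combine into
    the weight [1/p - 1]. *)
Lemma pdivergenceE (rho : M) : rho \is hermsymmx ->
  pdivergence p sigma rho = (p * (p - 1))^-1 * (trace_power p (G (- q) rho) - 1).
Proof.
move=> rh; have /andP[p1 p2] := p12; rewrite /pdivergence /pnorm GammaD//.
have -> : p^-1 + -1 = - q by rewrite hatpV; field; rewrite gt_eqF//; lra.
rewrite tr_mxabs_pow ?Gamma_herm//= -powRrM mulVf ?gt_eqF//; last lra.
by rewrite powRr1// sumr_ge0// => i _; rewrite powR_ge0.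
Qed.

Lemma is_derive_pdivergence (rho nu : M) : posdef rho -> nu \is hermsymmx ->
  is_derive (0 : R) (1 : R) (fun e : R => pdivergence p sigma (rho + e%:C *: nu))
    (complex.Re (hsdot (div_potential p sigma rho) nu)).
Proof.
move=> rp nuh; have /andP[p1 p2] := p12; have [rh _] := rp.
have Yp := Gamma_posdef sigma_pos (- q) rp; set Y := G (- q) rho in Yp.
set N := G (- q) nu; have Nh : N \is hermsymmx by exact: Gamma_herm.
have lineh (e : R) : rho + e%:C *: nu \is hermsymmx.
  by apply/hermP; rewrite dagD dagZr (hermP _ rh) (hermP _ nuh).
have lineY (e : R) : G (- q) (rho + e%:C *: nu) = Y + e%:C *: N.
  by rewrite -GammaZ; exact: linearD.
have -> : complex.Re (hsdot (div_potential p sigma rho) nu) =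
    (p * (p - 1))^-1 * (p * complex.Re (\tr (mxpow Y (p - 1) *m N))).
  rewrite /div_potential hsdotZl conjc_real hsdot_Gamma /hsdot mxpow_dag -/Y -/N.
  case: (\tr _) => a b /=; rewrite mul0r subr0 invfM; field.
  by rewrite !gt_eqF//; lra.
apply: (@is_derive_quadratic _ _ _ ((p * (p - 1))^-1 *
  ((\sum_i (spval Y i) `^ (p - 2)) * complex.Re (hsdot N N)))) => e.
have PE (x : R) : pdivergence p sigma (rho + x%:C *: nu) =
    (p * (p - 1))^-1 * (trace_power p (Y + x%:C *: N) - 1).
  by rewrite (pdivergenceE (lineh x)) lineY.
have Yeh : Y + e%:C *: N \is hermsymmx.
  by move: (Gamma_herm (- q) (lineh e)); rewrite lineY.
have Y0 : Y + 0%:C *: N = Y by rewrite scale0r addr0.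
have Ye : Y + e%:C *: N - Y = e%:C *: N by rewrite addrAC subrr add0r.
have := trace_power_expansion p12 Yp Yeh; rewrite (PE e) (PE 0) Y0 Ye.
rewrite hsdotZl hsdotZr conjc_real -scalemxAr mxtraceZ !Re_realM.
move: (trace_power _ _) (trace_power _ _) (complex.Re _) (complex.Re _) (\sum_i _).
move=> t0 t1 ns tr K H.
have k0 : 0 < (p * (p - 1))^-1 by rewrite invr_gt0 mulr_gt0//; lra.
have -> : (p * (p - 1))^-1 * (t1 - 1) - (p * (p - 1))^-1 * (t0 - 1) -
    e * ((p * (p - 1))^-1 * (p * tr)) = (p * (p - 1))^-1 * (t1 - t0 - p * (e * tr)).
  by ring.
rewrite normrM (gtr0_norm k0) -mulrA ler_pM2l//; apply: le_trans H _.
by rewrite le_eqVlt; apply/orP; left; apply/eqP; ring.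
Qed.

End Divergence.

(** * A real-valued norm inducing the topology of matrices *)

Section EntrywiseNorm.
Context {R : realType} {d : nat}.
Local Notation C := R[i].
Local Notation M := 'M[C]_d.
Implicit Types (z w : C) (X Y : M).

(** The norm of matrices over [R[i]] takes its values in [R[i]]. Estimates are
    carried out instead with this real, submultiplicative norm of a complex
    number and the sum of its values over the entries of a matrix. *)
Definition normc1 z : R := `|complex.Re z| + `|complex.Im z|.

Definition mxnorm1 X : R := \sum_i \sum_j normc1 (X i j).
Local Notation N := mxnorm1.

Lemma normc1_ge0 z : 0 <= normc1 z.
Proof. by rewrite addr_ge0. Qed.

Lemma normc1D z w : normc1 (z + w) <= normc1 z + normc1 w.
Proof.
case: z w => [a b] [a' b']; rewrite /normc1 /= addrACA.
by rewrite lerD// ler_normD.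
Qed.

Lemma normc1N z : normc1 (- z) = normc1 z.
Proof. by case: z => a b; rewrite /normc1 /= !normrN. Qed.

Lemma normc1_conj z : normc1 (z^*%C) = normc1 z.
Proof. by case: z => a b; rewrite /normc1 /= normrN. Qed.

Lemma normc1M z w : normc1 (z * w) <= normc1 z * normc1 w.
Proof.
case: z w => [a b] [a' b']; rewrite /normc1 /= mulrDl !mulrDr -!normrM.
have := ler_normB (a * a') (b * b'); have := ler_normD (a * b') (b * a').
by move=> H1 H2; apply: le_trans (lerD H2 H1) _; rewrite le_eqVlt; apply/orP; left; apply/eqP; ring.
Qed.

Lemma normc1Z (a : R) z : normc1 (a%:C * z) = `|a| * normc1 z.
Proof.
by case: z => x y; rewrite /normc1 /= !mul0r subr0 addr0 !normrM mulrDr.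
Qed.

Lemma normc10 : normc1 0 = 0.
Proof. by rewrite /normc1 /= normr0 addr0. Qed.

Lemma normc1_eq0 z : normc1 z = 0 -> z = 0.
Proof.
case: z => a b /eqP; rewrite /normc1 /= paddr_eq0// !normr_eq0.
by move=> /andP[/eqP -> /eqP ->].
Qed.

Lemma normc1_sum (I : finType) (F : I -> C) :
  normc1 (\sum_i F i) <= \sum_i normc1 (F i).
Proof.
elim/big_ind2 : _ => [|x y z w xy zw|//]; first by rewrite normc10.
exact: le_trans (normc1D _ _) (lerD xy zw).
Qed.

Lemma normr_le_normc1 z : `|z| <= (normc1 z)%:C.
Proof.
rewrite normc_def lecR; case: z => a b; rewrite /normc1 /=.
rewrite -[leRHS]ger0_norm ?addr_ge0// -sqrtr_sqr ler_sqrt ?sqr_ge0// sqrrD.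
by rewrite !real_normK ?num_real// lerD2r lerDl mulrn_wge0// mulr_ge0.
Qed.

Lemma normc1_le_normr z : (normc1 z)%:C <= `|z| *+ 2.
Proof.
rewrite /normc1 rmorphD mulr2n lerD//; first exact: normc_ge_Re.
by case: z => a b; rewrite normc_def lecR /= -sqrtr_sqr ler_wsqrtr// lerDr sqr_ge0.
Qed.

Lemma mxnorm1_ge0 X : 0 <= N X.
Proof. by apply: sumr_ge0 => i _; apply: sumr_ge0 => j _; exact: normc1_ge0. Qed.

Lemma mxnorm1D X Y : N (X + Y) <= N X + N Y.
Proof.
rewrite /mxnorm1 -big_split; apply: ler_sum => i _ /=; rewrite -big_split.
by apply: ler_sum => j _ /=; rewrite mxE normc1D.
Qed.

Lemma mxnorm1N X : N (- X) = N X.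
Proof. by apply: eq_bigr => i _; apply: eq_bigr => j _; rewrite mxE normc1N. Qed.

Lemma mxnorm1B X Y : N (X - Y) <= N X + N Y.
Proof. by rewrite -(mxnorm1N Y) mxnorm1D. Qed.

Lemma mxnorm10 : N 0 = 0.
Proof.
by rewrite /mxnorm1 big1// => i _; rewrite big1// => j _; rewrite mxE normc10.
Qed.

Lemma mxnorm1_sum (I : finType) (F : I -> M) : N (\sum_i F i) <= \sum_i N (F i).
Proof.
elim/big_ind2 : _ => [|x y z w xy zw|//]; first by rewrite mxnorm10.
exact: le_trans (mxnorm1D _ _) (lerD xy zw).
Qed.

Lemma mxnorm1_nat_sum (F : nat -> M) n :
  N (\sum_(0 <= i < n) F i) <= \sum_(0 <= i < n) N (F i).
Proof.
elim/big_ind2 : _ => [|x y z w xy zw|//]; first by rewrite mxnorm10.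
exact: le_trans (mxnorm1D _ _) (lerD xy zw).
Qed.

Lemma mxnorm1Zr (a : R) X : N (a%:C *: X) = `|a| * N X.
Proof.
rewrite /mxnorm1 mulr_sumr; apply: eq_bigr => i _; rewrite mulr_sumr.
by apply: eq_bigr => j _; rewrite mxE normc1Z.
Qed.

Lemma mxnorm1Z z X : N (z *: X) <= normc1 z * N X.
Proof.
rewrite /mxnorm1 mulr_sumr; apply: ler_sum => i _; rewrite mulr_sumr.
by apply: ler_sum => j _; rewrite mxE normc1M.
Qed.

Lemma normc1_entry X i j : normc1 (X i j) <= N X.
Proof.
rewrite /mxnorm1 (bigD1 i)//= (bigD1 j)//= -addrA lerDl addr_ge0//.
  by apply: sumr_ge0 => k _; exact: normc1_ge0.
by apply: sumr_ge0 => k _; apply: sumr_ge0 => l _; exact: normc1_ge0.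
Qed.

Lemma normc1_hsdot X Y : normc1 (hsdot X Y) <= N X * N Y.
Proof.
rewrite hsdotE /mxnorm1 mulr_suml; apply: le_trans (normc1_sum _) _.
apply: ler_sum => i _; rewrite mulr_suml; apply: le_trans (normc1_sum _) _.
apply: ler_sum => j _; apply: le_trans (normc1M _ _) _.
by rewrite normc1_conj ler_wpM2l ?normc1_ge0// normc1_entry.
Qed.

Lemma mxnorm1_linear_le (T : {linear M -> M}) (c : R) X :
  (forall i j, N (T (delta_mx i j)) <= c) -> N (T X) <= c * N X.
Proof.
move=> Tc; rewrite {1}(matrix_sum_delta X) linear_sum.
rewrite [c * _]mulr_sumr; apply: le_trans (mxnorm1_sum _) _; apply: ler_sum => i _.
rewrite linear_sum mulr_sumr; apply: le_trans (mxnorm1_sum _) _.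
apply: ler_sum => j _; rewrite linearZ; apply: le_trans (mxnorm1Z _ _) _.
by rewrite mulrC ler_wpM2r ?normc1_ge0.
Qed.

Lemma mxnorm1_bound (T : {linear M -> M}) :
  exists2 B : R, 0 <= B & forall X, N (T X) <= B * N X.
Proof.
exists (\sum_i \sum_j N (T (delta_mx i j))).
  by apply: sumr_ge0 => i _; apply: sumr_ge0 => j _; exact: mxnorm1_ge0.
move=> X; apply: mxnorm1_linear_le => i j.
rewrite (bigD1 i)//= (bigD1 j)//= -addrA lerDl addr_ge0//.
  by apply: sumr_ge0 => k _; exact: mxnorm1_ge0.
by apply: sumr_ge0 => k _; apply: sumr_ge0 => l _; exact: mxnorm1_ge0.
Qed.

(** Both norms induce the same topology, by comparison with the supremum of the
    moduli of the entries. *)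
Lemma cvg_mxnorm1 (T : Type) (F : set_system T) (FF : Filter F) (f : T -> M) (D : M) :
  f @ F --> D <-> forall e : R, 0 < e -> \forall x \near F, N (f x - D) < e.
Proof.
split => [/cvg_ballP H e e0|H].
  have k0 : 0 < e / (d * d).*2.+1%:R by rewrite divr_gt0.
  have /H : 0 < (e / (d * d).*2.+1%:R)%:C by rewrite ltcR.
  apply: filterS => x [_ Hx].
  have E : e = (d * d).*2.+1%:R * (e / (d * d).*2.+1%:R).
    by rewrite mulrCA divff ?mulr1// pnatr_eq0.
  rewrite E; move: (e / _) k0 Hx => k k0 Hx.
  have Nk : N (f x - D) <= (d * d).*2%:R * k.
    have -> : (d * d).*2%:R * k = \sum_(i < d) \sum_(j < d) (k *+ 2).
      rewrite !sumr_const !card_ord -!mulrnA mulr_natl; congr (_ *+ _).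
      by rewrite -mul2n mulnA.
    apply: ler_sum => i _; apply: ler_sum => j _.
    rewrite -lecR; apply: le_trans (normc1_le_normr _) _.
    rewrite rmorphMn /= lerMn2r orFb ltW//.
    by rewrite !mxE distrC; have := Hx i j.
  by apply: le_lt_trans Nk _; rewrite -natr1 mulrDl mul1r ltrDl.
apply/cvg_ballP => eps eps0.
have [e epsE] : exists e : R, eps = e%:C.
  by exists (complex.Re eps); rewrite RRe_real// gtr0_real.
move: eps0; rewrite epsE ltcR => e0; have := H e e0.
apply: filterS => x Hx; split; first by rewrite ltcR.
move=> i j; rewrite -ball_normE /ball_ /= distrC.
apply: le_lt_trans (normr_le_normc1 _) _; rewrite ltcR.
by apply: le_lt_trans Hx; have := normc1_entry (f x - D) i j; rewrite !mxE.
Qed.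

End EntrywiseNorm.

(** * Exponentials of superoperators *)

Section SuperoperatorExponential.
Context {R : realType} {d : nat}.
Local Notation C := R[i].
Local Notation M := 'M[C]_d.
Local Notation N := mxnorm1.

Lemma cvg_mx_entries (T : Type) (F : set_system T) (FF : Filter F)
    (f : T -> M) (D : M) :
  (forall i j, complex.Re (f x i j) @[x --> F] --> complex.Re (D i j)) ->
  (forall i j, complex.Im (f x i j) @[x --> F] --> complex.Im (D i j)) ->
  f @ F --> D.
Proof.
move=> HR HI; apply/cvg_ballP => eps eps0.
have [e epsE] : exists e : R, eps = e%:C.
  by exists (complex.Re eps); rewrite RRe_real// gtr0_real.
move: eps0; rewrite epsE ltcR => e0.
have e2 : 0 < e / 2 by rewrite divr_gt0.
have near_ij i j : \forall x \near F, ball (D i j) e%:C (f x i j).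
  have /cvgrPdist_lt/(_ _ e2) H1 := HR i j; have /cvgrPdist_lt/(_ _ e2) H2 := HI i j.
  apply: filterS2 H1 H2 => x H1 H2; rewrite -ball_normE /ball_ /=.
  apply: le_lt_trans (normr_le_normc1 _) _; rewrite ltcR.
  move: H1 H2; case: (D i j) (f x i j) => [a b] [a' b']; rewrite /normc1 /=.
  by move=> H1 H2; rewrite [e]splitr ltrD.
have : \forall x \near F, forall i j, ball (D i j) e%:C (f x i j).
  by apply: filter_forall => i; apply: filter_forall => j; exact: near_ij.
by apply: filterS => x Hx; split; rewrite ?ltcR.
Qed.

Variable K : {linear M -> M}.

Definition exp_term (t : R) (X : M) (n : nat) : M :=
  (t ^+ n / n`!%:R)%:C *: iter n K X.

Variable B : R.
Hypothesis B0 : 0 <= B.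
Hypothesis KB : forall X, N (K X) <= B * N X.

Lemma iter_bound n X : N (iter n K X) <= B ^+ n * N X.
Proof.
elim: n => [|n IH]; first by rewrite mul1r.
by rewrite exprS -mulrA /=; apply: le_trans (KB _) _; rewrite ler_wpM2l.
Qed.

Lemma exp_term_bound t X n : N (exp_term t X n) <= exp_coeff (B * `|t|) n * N X.
Proof.
rewrite /exp_term mxnorm1Zr normrM normfV normrX normr_nat /exp_coeff /= exprMn.
rewrite [leRHS](_ : _ = `|t| ^+ n / n`!%:R * (B ^+ n * N X)); last by ring.
by rewrite ler_wpM2l ?iter_bound// divr_ge0 ?exprn_ge0.
Qed.

Lemma series_exp_coeff_le (x : R) n : 0 <= x -> series (exp_coeff x) n <= expR x.
Proof.
move=> x0; apply: nondecreasing_cvgn_le; last exact: is_cvg_series_exp_coeff.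
by apply: nondecreasing_series => k _ _; exact: exp_coeff_ge0.
Qed.

(** The real and imaginary parts of each entry are dominated by the scalar
    exponential series at [B * |t|]. *)
Lemma superexp_cvg t X : series (exp_term t X) @ \oo --> superexp t K X.
Proof.
have cv (f : C -> R) : (forall z w, f (z + w) = f z + f w) -> f 0 = 0 ->
    (forall z, `|f z| <= normc1 z) ->
    forall i j, cvgn (fun n => f (series (exp_term t X) n i j)).
  move=> fD f0 fN i j.
  have -> : (fun n => f (series (exp_term t X) n i j)) =
      series (fun n => f (exp_term t X n i j)).
    apply/funext => n; rewrite /series /= summxE.
    by apply: (big_morph f fD f0).
  apply: normed_cvg; apply: (@series_le_cvg _ _ (fun n => exp_coeff (B * `|t|) n * N X)) => //.
    by move=> n /=.
    by move=> n; rewrite mulr_ge0 ?mxnorm1_ge0// exp_coeff_ge0// mulr_ge0.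
    move=> n; apply: le_trans (fN _) _; apply: le_trans (normc1_entry _ i j) _.
    exact: exp_term_bound.
  have -> : (fun n => exp_coeff (B * `|t|) n * N X) = N X *: exp_coeff (B * `|t|).
    by apply/funext => n; rewrite mulrC.
  by apply: is_cvg_seriesZ; exact: is_cvg_series_exp_coeff.
have cR := cv (@complex.Re R); have cI := cv (@complex.Im R).
have {}cR i j : cvgn (fun n => complex.Re (series (exp_term t X) n i j)).
  apply: cR => //; first by case=> ? ? [].
  by move=> z; rewrite /normc1 lerDl.
have {}cI i j : cvgn (fun n => complex.Im (series (exp_term t X) n i j)).
  apply: cI => //; first by case=> ? ? [].
  by move=> z; rewrite /normc1 lerDr.
pose l : M := \matrix_(i, j) Complex
  (lim ((fun n => complex.Re (series (exp_term t X) n i j)) @ \oo))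
  (lim ((fun n => complex.Im (series (exp_term t X) n i j)) @ \oo)).
have cl : series (exp_term t X) @ \oo --> l.
  by apply: cvg_mx_entries => i j; rewrite mxE; [exact: cR|exact: cI].
suff -> : superexp t K X = l by [].
exact: cvg_lim cl.
Qed.

Lemma superexp_dist t X (e : R) : 0 < e ->
  \forall n \near \oo, N (series (exp_term t X) n - superexp t K X) < e.
Proof. by have /cvg_mxnorm1 := @superexp_cvg t X; apply. Qed.

Lemma superexp_const t X : (forall n, exp_term t X n.+1 = 0) -> superexp t K X = X.
Proof.
move=> t0; apply: (@cvg_lim M) => //; apply: cvg_near_cst; near=> n.
have n0 : (0 < n)%N by near: n; exact: nbhs_infty_gt.
rewrite -[n]prednK// /series /= big_nat_recl// big1 => [|k _]; last exact: t0.
by rewrite addr0 expr0 fact0 divr1 scale1r.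
Unshelve. all: by end_near. Qed.

Lemma superexp0 X : superexp 0 K X = X.
Proof.
by apply: superexp_const => n; rewrite /exp_term expr0n mul0r scale0r.
Qed.

Lemma superexp_fixed t X : K X = 0 -> superexp t K X = X.
Proof.
move=> KX; apply: superexp_const => n; rewrite /exp_term iterSr KX.
suff -> : iter n K 0 = 0 by rewrite scaler0.
by elim: n => //= n ->; rewrite linear0.
Qed.

Definition taylor_rem (t h : R) (k : nat) : R :=
  (t + h) ^+ k - t ^+ k - k%:R * h * t ^+ k.-1.

Lemma taylor_remS t h k : taylor_rem t h k.+1 =
  (t + h) * taylor_rem t h k + k%:R * h ^+ 2 * t ^+ k.-1.
Proof.
rewrite /taylor_rem; case: k => [|k] /=; first by rewrite !expr0 expr1; ring.
by rewrite !exprS -!natr1; ring.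
Qed.

(** Induction on the recurrence [taylor_remS]. *)
Lemma taylor_rem_bound t h m : `|taylor_rem t h m.+2| <=
  m.+2%:R * m.+1%:R * h ^+ 2 * (`|t| + `|h|) ^+ m.
Proof.
elim: m => [|m IH].
  rewrite /taylor_rem (_ : _ - _ = h ^+ 2); last by rewrite /=; ring.
  by rewrite ger0_norm ?sqr_ge0// expr0 mulr1 mulr1 ler_peMl ?sqr_ge0// ler1n.
rewrite taylor_remS; apply: le_trans (ler_normD _ _) _.
set s := `|t| + `|h| in IH *; have s0 : 0 <= s by rewrite addr_ge0.
have H1 : `|(t + h) * taylor_rem t h m.+2| <= s * (m.+2%:R * m.+1%:R * h ^+ 2 * s ^+ m).
  by rewrite normrM ler_pM ?ler_normD.
have H2 : `|m.+2%:R * h ^+ 2 * t ^+ m.+2.-1| <= m.+2%:R * h ^+ 2 * s ^+ m.+1.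
  rewrite normrM normrM normr_nat (ger0_norm (sqr_ge0 h)) normrX.
  rewrite (ler_wpM2l (mulr_ge0 (ler0n _ _) (sqr_ge0 h)))//.
  by rewrite lerXn2r ?nnegrE// lerDl.
apply: le_trans (lerD H1 H2) _; rewrite (exprS s m).
have -> : m.+3%:R = m.+1%:R + 2 :> R by rewrite -natrD addn2.
have -> : m.+2%:R = m.+1%:R + 1 :> R by rewrite natr1.
have b0 : 0 <= m.+1%:R :> R by [].
rewrite -subr_ge0; move: (m.+1%:R) b0 => b b0.
rewrite (_ : _ - _ = (b + 1) * (h ^+ 2 * (s * s ^+ m))); last by ring.
have sm0 := mulr_ge0 s0 (exprn_ge0 m s0).
by rewrite mulr_ge0 ?addr_ge0 ?(mulr_ge0 (sqr_ge0 h) sm0).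
Qed.

(** The Taylor remainder of order two, estimated term by term in the series. *)
Lemma partial_exp_taylor t h X n :
  N (series (exp_term (t + h) X) n.+2 - series (exp_term t X) n.+2
     - h%:C *: K (series (exp_term t X) n.+1)) <=
  h ^+ 2 * (B ^+ 2 * (expR (B * (`|t| + `|h|)) * N X)).
Proof.
set s := `|t| + `|h|; have s0 : 0 <= s by rewrite addr_ge0.
have E : series (exp_term (t + h) X) n.+2 - series (exp_term t X) n.+2
     - h%:C *: K (series (exp_term t X) n.+1) =
  \sum_(0 <= k < n) (taylor_rem t h k.+2 / k.+2`!%:R)%:C *: iter k.+2 K X.
  have Ek : h%:C *: K (series (exp_term t X) n.+1) =
      \sum_(0 <= k < n.+2) (k%:R * h * t ^+ k.-1 / k`!%:R)%:C *: iter k K X.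
    rewrite [RHS]big_nat_recl// !mul0r scale0r add0r /series /= linear_sum scaler_sumr.
    apply: eq_bigr => k _; rewrite linearZ scalerA -rmorphM; congr (_%:C *: _).
    rewrite factS natrM /=; field.
    by rewrite nat1r !pnatr_eq0 -lt0n fact_gt0.
  transitivity (\sum_(0 <= k < n.+2)
      (taylor_rem t h k / k`!%:R)%:C *: iter k K X).
    rewrite Ek /series -2!sumrB; apply: eq_bigr => k _.
    by rewrite /exp_term -2!scalerBl -2!rmorphB -2!mulrBl.
  rewrite big_nat_recl// big_nat_recl// {1 2}/taylor_rem /= !expr0 !expr1.
  rewrite (_ : 1 - 1 - _ = 0); last by ring.
  rewrite (_ : t + h - t - _ = 0); last by ring.
  by rewrite !mul0r !scale0r !add0r.
rewrite E; apply: le_trans (mxnorm1_nat_sum _ _) _.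
apply: le_trans (_ : \sum_(0 <= k < n)
    h ^+ 2 * (B ^+ 2 * (exp_coeff (B * s) k * N X)) <= _).
  apply: ler_sum => k _; rewrite mxnorm1Zr normrM normfV normr_nat.
  have f0 : 0 < k`!%:R :> R by rewrite ltr0n fact_gt0.
  apply: le_trans (ler_wpM2l _ (iter_bound _ _)) _; first by rewrite divr_ge0.
  have -> : h ^+ 2 * (B ^+ 2 * (exp_coeff (B * s) k * N X)) =
      k.+2%:R * k.+1%:R * h ^+ 2 * s ^+ k / k.+2`!%:R * (B ^+ k.+2 * N X).
    rewrite /exp_coeff /= exprMn !factS !natrM !exprS; field.
    by rewrite nat1r -[2 + _](natrD _ 2 k) !pnatr_eq0 -lt0n fact_gt0.
  apply: ler_wpM2r; first by rewrite mulr_ge0 ?exprn_ge0 ?mxnorm1_ge0.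
  by apply: ler_wpM2r; [rewrite invr_ge0|exact: taylor_rem_bound].
rewrite -!mulr_sumr -mulr_suml; apply: (ler_wpM2l (sqr_ge0 h)).
apply: (ler_wpM2l (sqr_ge0 B)); rewrite ler_wpM2r ?mxnorm1_ge0//.
by apply: series_exp_coeff_le; rewrite mulr_ge0.
Qed.

Lemma superexp_taylor t h X :
  N (superexp (t + h) K X - superexp t K X - h%:C *: K (superexp t K X)) <=
  h ^+ 2 * (B ^+ 2 * (expR (B * (`|t| + `|h|)) * N X)).
Proof.
set b := leRHS; apply/ler_addgt0Pr => e e0.
have k0 : 0 < e / (3 + `|h| * B) by rewrite divr_gt0// ltr_wpDr ?mulr_ge0.
have := superexp_dist (t + h) X k0; have := superexp_dist t X k0.
move=> [m _ Hm] [n _ Hn]; pose k := (maxn m n).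
have km : (m <= k)%N by rewrite leq_maxl.
have kn : (n <= k)%N by rewrite leq_maxr.
have H1 := Hm k.+1 (leqW km); have H2 := Hm k.+2 (leqW (leqW km)).
have H3 := Hn k.+2 (leqW (leqW kn)).
have := partial_exp_taylor t h X k; rewrite -/b.
rewrite /= in H1 H2 H3; move: (superexp _ _ _) (superexp _ _ _) H1 H2 H3 => E E'.
move: (series _ _) (series _ _) (series _ _) => S3 S2 S1 H1 H2 H3 H4.
have -> : E - E' - h%:C *: K E' = (S3 - S2 - h%:C *: K S1) +
    ((S2 - E') - (S3 - E) + h%:C *: K (S1 - E')).
  have -> : h%:C *: K (S1 - E') = h%:C *: K S1 - h%:C *: K E'.
    by rewrite raddfB scalerBr.
  by apply/matrixP => i j; rewrite !mxE; ring.
have Hh : N (h%:C *: K (S1 - E')) <= `|h| * B * (e / (3 + `|h| * B)).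
  rewrite mxnorm1Zr -mulrA ler_wpM2l//; apply: le_trans (KB _) _.
  by rewrite ler_wpM2l// ltW.
apply: le_trans (mxnorm1D _ _) _; apply: lerD => //.
apply: le_trans (mxnorm1D _ _) _; have H5 := mxnorm1B (S2 - E') (S3 - E).
have E0 : e = (3 + `|h| * B) * (e / (3 + `|h| * B)).
  by rewrite mulrCA divff ?mulr1// gt_eqF// ltr_wpDr ?mulr_ge0.
rewrite mulrDl in E0; move: (e / _) E0 Hh H1 H2 H3 => c E0 Hh H1 H2 H3.
have c0 : 0 <= c by apply: le_trans (mxnorm1_ge0 _) (ltW H1).
by rewrite E0; apply: lerD => //; lra.
Qed.

Lemma superexp_bound t X : N (superexp t K X) <= expR (B * `|t|) * N X.
Proof.
apply/ler_addgt0Pr => e e0; have [m _ Hm] := superexp_dist t X e0.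
have {}Hm := Hm m (leqnn m); rewrite /= in Hm.
rewrite -(subKr (series (exp_term t X) m) (superexp t K X)).
apply: le_trans (mxnorm1B _ _) _; apply: lerD; last exact: ltW.
apply: le_trans (mxnorm1_nat_sum _ _) _.
apply: le_trans (_ : \sum_(0 <= k < m) exp_coeff (B * `|t|) k * N X <= _).
  by apply: ler_sum => k _; exact: exp_term_bound.
rewrite -mulr_suml ler_wpM2r ?mxnorm1_ge0//.
by apply: series_exp_coeff_le; rewrite mulr_ge0.
Qed.

(** The remainder is quadratic in [h], locally uniformly in [t]. *)
Lemma superexp_deriv t X :
  mx_deriv_at (fun s => superexp s K X) t (K (superexp t K X)).
Proof.
rewrite /mx_deriv_at; apply/cvg_mxnorm1 => e e0.
pose b := B ^+ 2 * (expR (B * (`|t| + 1)) * N X).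
have b0 : 0 <= b by rewrite !mulr_ge0 ?expR_ge0 ?mxnorm1_ge0 ?exprn_ge0.
near=> h.
have h0 : h != 0 by near: h; exact: nbhs_dnbhs_neq.
have h1 : `|h| < 1 by near: h; exact: dnbhs0_lt.
have hb : `|h| < e / (b + 1) by near: h; apply: dnbhs0_lt; rewrite divr_gt0// ltr_wpDl.
have -> : (h^-1)%:C *: (superexp (t + h) K X - superexp t K X) - K (superexp t K X) =
    (h^-1)%:C *: (superexp (t + h) K X - superexp t K X - h%:C *: K (superexp t K X)).
  by rewrite [RHS]scalerBr scalerA -rmorphM mulVf// scale1r.
rewrite mxnorm1Zr normfV ltr_pdivrMl ?normr_gt0//.
apply: le_lt_trans (superexp_taylor t h X) _.
rewrite -(real_normK (num_real h)) expr2 -mulrA ltr_pM2l ?normr_gt0//.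
move: hb; rewrite ltr_pdivlMr ?ltr_wpDl//; apply: le_lt_trans.
apply: ler_wpM2l => //; apply: le_trans (_ : b <= _); last by rewrite lerDl.
rewrite /b ler_wpM2l ?sqr_ge0// ler_wpM2r ?mxnorm1_ge0// ler_expR.
by rewrite ler_wpM2l// lerD2l ltW.
Unshelve. all: by end_near. Qed.

End SuperoperatorExponential.

(** * The generator determines the semigroup *)

Section SemigroupExponential.
Context {R : realType} {d : nat}.
Local Notation C := R[i].
Local Notation M := 'M[C]_d.
Local Notation N := mxnorm1.
Variables (P : R -> {linear M -> M}) (L : {linear M -> M}).
Hypothesis P0 : forall X, P 0 X = X.
Hypothesis PD : forall s t, 0 <= s -> 0 <= t -> forall X, P (s + t) X = P s (P t X).
Hypothesis PL : is_generator P L.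

(** Pointwise differentiability at [0] is uniform on bounded sets, since a
    linear map is controlled by its values on the matrix units. *)
Lemma generator_uniform (e : R) : 0 < e ->
  exists2 del : R, 0 < del & forall h, 0 < h < del ->
    forall X, N (P h X - X - h%:C *: L X) <= e * h * N X.
Proof.
move=> e0.
have near_ij i j : \forall h \near (0 : R)^'+,
    N ((h^-1)%:C *: (P h (delta_mx i j) - delta_mx i j) - L (delta_mx i j)) < e.
  by have /cvg_mxnorm1 := @PL (delta_mx i j); apply.
have : \forall h \near (0 : R)^'+, forall i j,
    N ((h^-1)%:C *: (P h (delta_mx i j) - delta_mx i j) - L (delta_mx i j)) < e.
  by apply: filter_forall => i; apply: filter_forall => j; exact: near_ij.
move=> /nbhs_ballP[del /= del0 H]; exists del => // h /andP[h0 hdel] X.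
have {}H i j : N (P h (delta_mx i j) - delta_mx i j - h%:C *: L (delta_mx i j)) <= e * h.
  have hb : ball (0 : R) del h by rewrite -ball_normE /ball_ /= sub0r normrN gtr0_norm.
  have := H h hb h0 i j.
  have -> : (h^-1)%:C *: (P h (delta_mx i j) - delta_mx i j) - L (delta_mx i j) =
      (h^-1)%:C *: (P h (delta_mx i j) - delta_mx i j - h%:C *: L (delta_mx i j)).
    by rewrite [RHS]scalerBr scalerA -rmorphM mulVf ?gt_eqF// scale1r.
  rewrite mxnorm1Zr normfV gtr0_norm// ltr_pdivrMl// mulrC.
  exact: ltW.
pose T : {linear M -> M} := P h \- idfun \- (h%:C \*: L).
exact: (@mxnorm1_linear_le _ _ T (e * h) X H).
Qed.

(** Submultiplicativity turns [N (P h X) <= (1 + c h) N X] for small [h] into an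
    exponential bound along multiples of [h]. *)
Lemma semigroup_growth : exists2 c : R, 0 <= c & exists2 del : R, 0 < del &
  forall h, 0 < h < del -> forall n X,
    N (P (n%:R * h) X) <= expR (c * (n%:R * h)) * N X.
Proof.
have [BL BL0 LB] := mxnorm1_bound L.
have [del del0 H] := generator_uniform (@ltr01 R).
exists (BL + 1); first by rewrite addr_ge0.
exists del => // h hdel; have /andP[h0 _] := hdel; elim=> [|n IH] X.
  by rewrite !mul0r mulr0 expR0 mul1r P0.
rewrite -natr1 mulrDl mul1r addrC (PD (ltW h0)) ?mulr_ge0 ?(ltW h0)//.
rewrite mulrDr expRD -mulrA; move: (P _ X) (IH X) => Z HZ.
apply: le_trans (_ : expR ((BL + 1) * h) * N Z <= _); last by rewrite ler_wpM2l ?expR_ge0.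
apply: le_trans (_ : (1 + (BL + 1) * h) * N Z <= _); last first.
  by rewrite ler_wpM2r ?mxnorm1_ge0// expR_ge1Dx.
have -> : P h Z = (P h Z - Z - h%:C *: L Z) + (Z + h%:C *: L Z).
  by rewrite addrA (addrAC _ _ Z) subrK subrK.
apply: le_trans (mxnorm1D _ _) _.
have H2 : N (h%:C *: L Z) <= h * (BL * N Z).
  by rewrite mxnorm1Zr gtr0_norm// ler_wpM2l// ltW.
have H3 := mxnorm1D Z (h%:C *: L Z); have H1 := H h hdel Z.
by apply: le_trans (lerD H1 (le_trans H3 (lerD (lexx _) H2))) _; lra.
Qed.

Lemma normc1_nat_sum (F : nat -> C) n :
  normc1 (\sum_(0 <= i < n) F i) <= \sum_(0 <= i < n) normc1 (F i).
Proof.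
elim/big_ind2 : _ => [|x y z w xy zw|//]; first by rewrite normc10.
exact: le_trans (normc1D _ _) (lerD xy zw).
Qed.

(** With [T = n h], telescope the pairing of [P (k h) X] with the exponential
    at time [T - k h] of the adjoint generator, applied to [Y]: each of the [n]
    increments is [o(h)] because its two first order terms cancel. *)
Lemma semigroup_duality (T : R) (X Y : M) : 0 <= T ->
  hsdot (P T X) Y = hsdot X (superexp T (superadj L) Y).
Proof.
have [B B0 KB] := mxnorm1_bound (superadj L).
rewrite le_eqVlt => /orP[/eqP <-|T0]; first by rewrite P0 superexp0.
have [c c0 [del1 del10 HP]] := semigroup_growth.
pose a := expR (c * T) * N X; pose b := expR (B * T) * N Y.
have a0 : 0 <= a by rewrite mulr_ge0 ?expR_ge0 ?mxnorm1_ge0.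
have b0 : 0 <= b by rewrite mulr_ge0 ?expR_ge0 ?mxnorm1_ge0.
pose K0 := T * (a * b * (1 + B ^+ 2)).
have ab0 : 0 <= a * b * (1 + B ^+ 2).
  by rewrite (mulr_ge0 (mulr_ge0 a0 b0))// addr_ge0// sqr_ge0.
have K00 : 0 <= K0 := mulr_ge0 (ltW T0) ab0.
apply/eqP; rewrite -subr_eq0; apply/eqP/normc1_eq0/eqP.
rewrite eq_le normc1_ge0 andbT; apply/ler_addgt0Pr => eta eta0; rewrite add0r.
pose e := eta / (K0 + 1).
have e0 : 0 < e by rewrite divr_gt0// ltr_wpDl.
apply: le_trans (_ : K0 * e <= _); last first.
  rewrite /e mulrCA (ler_piMr (ltW eta0))// ler_pdivrMr ?ltr_wpDl// mul1r.
  by rewrite lerDl.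
have [del2 del20 HL] := generator_uniform e0.
pose del := Num.min e (Num.min del1 del2).
have del0 : 0 < del by rewrite !lt_min e0 del10.
pose n := Num.bound (T / del).
have nT : T / del < n%:R by apply: archi_boundP; rewrite divr_ge0 ?ltW.
have n0 : 0 < n%:R :> R by apply: lt_trans nT; rewrite divr_gt0.
pose h := T / n%:R.
have h0 : 0 < h by rewrite divr_gt0.
have hdel : h < del by rewrite ltr_pdivrMr// mulrC -ltr_pdivrMr.
have nh : n%:R * h = T by rewrite mulrCA divff ?mulr1// gt_eqF.
move: hdel; rewrite !lt_min => /and3P[he hd1 hd2].
pose f k := hsdot (P (k%:R * h) X) (superexp (T - k%:R * h) (superadj L) Y).
have -> : hsdot (P T X) Y - hsdot X (superexp T (superadj L) Y) =
    \sum_(0 <= k < n) (f k.+1 - f k).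
  have fn : f n = hsdot (P T X) Y by rewrite /f nh (subrr T) superexp0.
  have f0 : f 0 = hsdot X (superexp T (superadj L) Y).
    by rewrite /f (mul0r h) (subr0 T) P0.
  rewrite (telescope_sumr f (leq0n n)).
  rewrite -[X in X - _ = _]fn -[X in _ - X = _]f0.
  by [].
apply: le_trans (normc1_nat_sum _ _) _.
apply: le_trans (_ : \sum_(0 <= k < n) (h * (a * b * (1 + B ^+ 2)) * e) <= _); last first.
  by rewrite sumr_const_nat subn0 -mulr_natl /K0 -nh !mulrA.
rewrite !big_mkord; apply: ler_sum => k _; rewrite /f.
have kh : k.+1%:R * h = h + k%:R * h by rewrite -natr1; ring.
have knT : h + k%:R * h <= T by rewrite -kh -nh (ler_wpM2r (ltW h0))// ler_nat.
have k0 : 0 <= k%:R * h by rewrite mulr_ge0// ltW.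
rewrite kh PD ?(ltW h0)//; have := HP h _ k X; rewrite h0 hd1 => /(_ isT) HZ.
have {HZ} Za : N (P (k%:R * h) X) <= a.
  apply: le_trans HZ _; rewrite ler_wpM2r ?mxnorm1_ge0// ler_expR ler_wpM2l//.
  by apply: le_trans knT; rewrite lerDr ltW.
move: (P _ X) Za => Z Za.
pose t := T - (h + k%:R * h); have t0 : 0 <= t by rewrite subr_ge0.
have -> : T - k%:R * h = t + h by rewrite /t; ring.
rewrite -/t.
have Wb := superexp_bound B0 KB t Y.
have Wt := superexp_taylor B0 KB t h Y.
move: (superexp (t + h) _ _) (superexp t _ _) Wb Wt => W W' Wb Wt.
have {}Wb : N W' <= b.
  apply: le_trans Wb _; rewrite ler_wpM2r ?mxnorm1_ge0// ler_expR ler_wpM2l//.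
  by rewrite ger0_norm// /t lerBlDr lerDl addr_ge0// ltW.
have {}Wt : N (W - W' - h%:C *: superadj L W') <= h ^+ 2 * (B ^+ 2 * b).
  apply: le_trans Wt _; rewrite ler_wpM2l ?sqr_ge0// ler_wpM2l ?sqr_ge0//.
  rewrite ler_wpM2r ?mxnorm1_ge0// ler_expR ler_wpM2l//.
  by rewrite !ger0_norm ?(ltW h0)// /t; lra.
have -> : hsdot (P h Z) W' - hsdot Z W =
    hsdot (P h Z - Z - h%:C *: L Z) W' - hsdot Z (W - W' - h%:C *: superadj L W').
  rewrite 2!(hsdotBl _ _ W') 2!(hsdotBr Z) (hsdotZl _ _ W') (hsdotZr _ Z) conjc_real.
  rewrite (hsdot_superadj L Z W').
  by move: (hsdot _ _) (hsdot _ _) (hsdot _ _) (hsdot _ _) => x y z w; ring.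
have := HL h _ Z; rewrite h0 hd2 => /(_ isT) HZ.
apply: le_trans (normc1D _ _) _; rewrite normc1N.
apply: le_trans (lerD (normc1_hsdot _ _) (normc1_hsdot _ _)) _.
have Q1 : N (P h Z - Z - h%:C *: L Z) * N W' <= e * h * a * b.
  apply: ler_pM => //; rewrite ?mxnorm1_ge0//; apply: le_trans HZ _.
  by apply: ler_wpM2l; rewrite // mulr_ge0 ?ltW.
have Q2 : N Z * N (W - W' - h%:C *: superadj L W') <= a * (h * e * (B ^+ 2 * b)).
  apply: ler_pM => //; rewrite ?mxnorm1_ge0//; apply: le_trans Wt _.
  apply: ler_wpM2r; first by rewrite mulr_ge0 ?exprn_ge0.
  by rewrite expr2; apply: ler_wpM2l; exact: ltW.
apply: le_trans (lerD Q1 Q2) _; rewrite le_eqVlt; apply/orP; left; apply/eqP.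
by ring.
Qed.

Lemma superadj_semigroup (T : R) (Y : M) : 0 <= T ->
  superadj (P T) Y = superexp T (superadj L) Y.
Proof. by move=> T0; apply: superadj_unique => X; exact: semigroup_duality. Qed.

End SemigroupExponential.

(** * Positivity and the dual semigroup *)

Section Positivity.
Context {R : realType} {d : nat}.
Local Notation C := R[i].
Local Notation M := 'M[C]_d.

Lemma block1_form (A : M) (u : 'cV[C]_d) :
  (\mxcol_(i < 1) u) ^t* *m \mxblock_(i < 1, j < 1) A *m \mxcol_(i < 1) u =
  u ^t* *m A *m u.
Proof.
have -> : (\mxcol_(i < 1) u) ^t* = \mxrow_(i < 1) u ^t*.
  by apply/matrixP => a b; rewrite !mxE.
by rewrite mul_mxrow_mxblock mul_mxrow_mxcol !big_ord1.
Qed.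

(** Blocks of size one turn complete positivity into positivity. *)
Lemma psdmx_block1 (A : M) : psdmx (\mxblock_(i < 1, j < 1) A) <-> psdmx A.
Proof.
have dagE1 (X : M) : (\mxblock_(i < 1, j < 1) X) ^t* = \mxblock_(i < 1, j < 1) X ^t*.
  by apply/matrixP => a b; rewrite !mxE.
split=> [[/hermP Ah A0]|[/hermP Ah A0]]; split.
- apply/hermP; have := congr1 (fun Z => submxblock Z ord0 ord0) Ah.
  by rewrite dagE1 !mxblockK.
- by move=> u; rewrite -block1_form; exact: A0.
- by apply/hermP; rewrite dagE1 Ah.
- move=> v; rewrite -(submxcolK v).
  have -> : \mxcol_i submxcol v i = \mxcol_(i < 1) submxcol v ord0.
    by apply: eq_mxcol => i; rewrite (ord1 i).
  by rewrite block1_form; exact: A0.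
Qed.

Lemma cp_positive (T : M -> M) X : completely_positive T -> psdmx X -> psdmx (T X).
Proof.
move=> Tcp /psdmx_block1 X0; apply/psdmx_block1.
exact: (Tcp 1%N (fun _ _ => X)).
Qed.

Definition qform (X : M) (u : 'rV[C]_d) : C := (u *m X *m u ^t*) 0 0.

Lemma form_psd X u : psdmx X -> 0 <= qform X u.
Proof. by move=> [_ /(_ (u ^t*))]; rewrite dagK. Qed.

Lemma tr_form X (u : 'rV[C]_d) : \tr (X *m (u ^t* *m u)) = qform X u.
Proof. by rewrite mulmxA mxtrace_mulC mulmxA /mxtrace big_ord1. Qed.

Lemma hsdot_form (X rho : M) : X \is hermsymmx -> rho \is hermsymmx ->
  hsdot X rho = \sum_i (spval rho i)%:C * qform X (row i (spectralmx rho)).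
Proof.
move=> Xh rh; rewrite /hsdot (hermP _ Xh) {1}(spectral_sum rh) mulmx_sumr raddf_sum.
by apply: eq_bigr => i _ /=; rewrite -scalemxAr mxtraceZ tr_form.
Qed.

Lemma tr_forms (X rho : M) : \tr X = \sum_i qform X (row i (spectralmx rho)).
Proof.
rewrite -{1}[X]mulmx1 -(sum_spproj rho) mulmx_sumr raddf_sum.
by apply: eq_bigr => i _ /=; rewrite tr_form.
Qed.

Lemma hsdot_psd_ge0 (X rho : M) : psdmx X -> psdmx rho -> 0 <= hsdot X rho.
Proof.
move=> X0 r0; rewrite hsdot_form; [|by case: X0|by case: r0].
by apply: sumr_ge0 => i _; rewrite mulr_ge0 ?form_psd// lecR psdmx_spval_ge0.
Qed.

(** Any positive definite matrix detects the vanishing of a positive one just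
    as the trace does. *)
Lemma hsdot_psd_eq0 (X rho : M) : psdmx X -> posdef rho ->
  hsdot X rho = 0 <-> \tr X = 0.
Proof.
move=> X0 [rh r0]; have Xh : X \is hermsymmx by case: X0.
rewrite hsdot_form// (tr_forms X rho).
have f0 i : 0 <= qform X (row i (spectralmx rho)) by exact: form_psd.
have sf0 i : 0 <= (spval rho i)%:C * qform X (row i (spectralmx rho)).
  by rewrite mulr_ge0// lecR ltW.
split=> /psumr_eq0P H; apply: big1 => i _; last first.
  by rewrite (H (fun k _ => f0 k) i isT) mulr0.
have /eqP := H (fun k _ => sf0 k) i isT; rewrite mulf_eq0 => /orP[|/eqP//].
by move=> /eqP/complexI s0; have := r0 i; rewrite s0 ltxx.
Qed.

(** The imaginary part of [A] is a self-adjoint matrix with vanishing quadratic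
    form, so its eigenvalues are zero. *)
Lemma form_ge0_herm (A : M) :
  (forall v : 'cV[C]_d, 0 <= (v ^t* *m A *m v) 0 0) -> A \is hermsymmx.
Proof.
move=> A0; pose E : M := 'i%C *: (A - A ^t*).
have Eh : E \is hermsymmx.
  apply/hermP; rewrite dagZ dagB dagK -opprB scalerN -scaleNr; congr (_ *: _).
  by apply/eqP; rewrite eq_complex /= opprK oppr0 !eqxx.
have E0 i : spval E i = 0.
  apply: complexI; rewrite spval_form//; set u := row i _.
  have [x ux] : exists x : R, (u *m A *m u ^t*) 0 0 = x%:C.
    have := A0 (u ^t*); rewrite dagK => /ger0_real/RRe_real <-; by eexists.
  have -> : u *m E *m u ^t* = 'i%C *: (u *m A *m u ^t* - (u *m A *m u ^t*) ^t*).
    by rewrite /E -scalemxAr -scalemxAl mulmxBr mulmxBl !dagM dagK mulmxA.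
  move: (u *m A *m u ^t*) ux => Z ux.
  have Z0 : (Z - Z ^t*) 0 0 = 0 by rewrite mxE [X in _ + X]mxE dagE ux conjc_real subrr.
  by rewrite mxE Z0 mulr0.
have EE : E = 0.
  rewrite (udiag_spec Eh) udiagE big1// => i _.
  by rewrite E0 scale0r.
apply/hermP/esym/eqP; rewrite -subr_eq0; apply/eqP.
have i0 : 'i%C != 0 :> C by rewrite eq_complex /= oner_eq0 andbF.
by move/eqP: EE; rewrite scaler_eq0 (negbTE i0) => /eqP.
Qed.

Lemma dyad_psd (v : 'cV[C]_d) : psdmx (v *m v ^t*).
Proof.
split=> [|w]; first by apply/hermP; rewrite dagM dagK.
have -> : w ^t* *m (v *m v ^t*) *m w = (w ^t* *m v) *m (w ^t* *m v) ^t*.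
  by rewrite dagM dagK !mulmxA.
by rewrite mxE big_ord1 dagE; have := mulcJ_ge0 ((w ^t* *m v) 0 0).
Qed.

Lemma hsdot_dyad (v : 'cV[C]_d) (A : M) :
  hsdot (v *m v ^t*) A = (v ^t* *m A *m v) 0 0.
Proof.
rewrite /hsdot dagM dagK -mulmxA mxtrace_mulC /mxtrace big_ord1.
by [].
Qed.

Variables (P : R -> {linear M -> M}) (sigma : M).
Hypothesis Pcp : forall t, 0 <= t -> completely_positive (P t).
Hypothesis P1 : forall t, 0 <= t -> P t 1%:M = 1%:M.
Hypothesis sigma_pos : posdef sigma.
Hypothesis sigma_inv : forall t, 0 <= t -> superadj (P t) sigma = sigma.

Lemma superadj_psd t rho : 0 <= t -> psdmx rho -> psdmx (superadj (P t) rho).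
Proof.
move=> t0 r0; have f0 (v : 'cV[C]_d) : 0 <= (v ^t* *m superadj (P t) rho *m v) 0 0.
  rewrite -hsdot_dyad -hsdot_superadj; apply: (hsdot_psd_ge0 _ r0).
  exact: cp_positive (Pcp t0) (dyad_psd v).
by split=> //; exact: form_ge0_herm.
Qed.

(** If the evolved state had a null vector, the image of the corresponding
    projection would be orthogonal to [rho], hence zero, hence orthogonal to
    [sigma]; but [sigma] is invariant and of full rank. *)
Lemma superadj_posdef t rho : 0 <= t -> posdef rho -> posdef (superadj (P t) rho).
Proof.
move=> t0 rp; have r0 := superadj_psd t0 (posdef_psd rp).
have rh : superadj (P t) rho \is hermsymmx by case: r0.
split=> // i; rewrite lt_neqAle psdmx_spval_ge0// andbT eq_sym; apply/eqP => s0.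
set X := spproj (superadj (P t) rho) i.
have X0 : psdmx X by have := dyad_psd ((row i (spectralmx (superadj (P t) rho))) ^t*); rewrite dagK.
have PX0 := cp_positive (Pcp t0) X0.
have /(hsdot_psd_eq0 PX0 rp) trPX : hsdot (P t X) rho = 0.
  rewrite hsdot_superadj /hsdot spproj_dag -[X in _ *m X](mxfun_id rh).
  by rewrite spproj_mxfunl s0 scale0r raddf0.
have : hsdot (P t X) sigma = 0 by exact/(hsdot_psd_eq0 PX0 sigma_pos).
rewrite hsdot_superadj sigma_inv// => /(hsdot_psd_eq0 X0 sigma_pos).
by rewrite tr_spproj => /eqP; rewrite oner_eq0.
Qed.

Lemma superadj_trace t rho : 0 <= t -> \tr (superadj (P t) rho) = \tr rho.
Proof.
move=> t0; have := hsdot_superadj (P t) 1%:M rho.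
by rewrite P1// /hsdot dag1 !mul1mx.
Qed.

End Positivity.

Section Irreducibility.
Context {R : realType} {d : nat}.
Local Notation C := R[i].
Local Notation M := 'M[C]_d.
Variables (P : R -> {linear M -> M}) (L : {linear M -> M}) (sigma : M).
Variables (J : nat) (V : 'I_J -> M) (omega c : 'I_J -> R).
Hypothesis d0 : (0 < d)%N.
Hypothesis P0 : forall X, P 0 X = X.
Hypothesis PD : forall s t, 0 <= s -> 0 <= t -> forall X, P (s + t) X = P s (P t X).
Hypothesis PL : is_generator P L.
Hypothesis sigma_pos : posdef sigma.
Hypothesis sigma_only : forall tau, invariant_state P tau -> tau = sigma.
Hypothesis LV : alicki_form sigma L V omega c.
Local Notation G := (Gamma sigma).

(** Moving [sigma ^ (1/2)] across [V] turns the flux of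
    [sigma ^ (1/2) A sigma ^ (1/2)] into
    [sigma ^ (1/2) (V A - A V) sigma ^ (1/2)]. *)
Lemma superadj_commutant (A : M) : (forall j, comm (V j) A = 0) ->
  superadj L (G 1 A) = 0.
Proof.
move=> VA; rewrite (superadj_alicki _ LV) big1 ?oppr0// => j _.
suff -> : (expR (- omega j / 2))%:C *: (V j *m G 1 A) -
    (expR (omega j / 2))%:C *: (G 1 A *m V j) = 0 by rewrite linear0.
have := modular_pow (1 / 2) sigma_pos (alicki_modularE sigma_pos LV j).
rewrite mul1r -mulNr /Gamma mul1r; have := VA j.
set e := expR (- omega j / 2); set e' := expR (omega j / 2).
have ee : e' * e = 1 by rewrite /e /e' -expRD mulNr subrr expR0.
move: (mxpow _ _) (V j) => S W /eqP; rewrite subr_eq0 => /eqP WA SW.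
apply/eqP; rewrite subr_eq0; apply/eqP.
rewrite -(mulmxA _ S W) SW -scalemxAr scalerA -rmorphM ee scale1r.
rewrite !mulmxA 2!scalemxAl -SW -(mulmxA S W A) WA.
by rewrite !mulmxA.
Qed.

(** Unless [A] is a scalar, [sigma ^ (1/2) (A + k) sigma ^ (1/2)], normalized,
    is a second invariant state. *)
Lemma commutant_herm (A : M) : A \is hermsymmx ->
  (forall j, comm (V j) A = 0) -> exists a, A = a%:M.
Proof.
move=> Ah VA; pose k := 1 + \sum_i `|spval A i|.
(* [k] exceeds the spectral radius of [A], so [A'] is positive definite. *)
pose A' := A + k%:C%:M.
have A'E : A' = udiag (spectralmx A) (fun i => spval A i + k).
  rewrite /A' {1}(udiag_spec Ah) -(udiag_cst k (spectral_unitarymx A)) !udiagE -big_split.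
  by apply: eq_bigr => i _; rewrite [in RHS]rmorphD [in RHS]scalerDl.
have A'p : posdef A'.
  rewrite A'E; apply: udiag_posdef => [|i]; first exact: spectral_unitarymx.
  have : `|spval A i| <= \sum_i `|spval A i| by rewrite (bigD1 i)//= lerDl sumr_ge0.
  by have := ler_norm (- spval A i); rewrite normrN /k; lra.
have VA' j : comm (V j) A' = 0.
  by rewrite linearD /= VA add0r -scalemx1 linearZ /= comm1 scaler0.
have tp := Gamma_posdef sigma_pos 1 A'p.
have [th ts] := tp.
pose t0 := \sum_i spval (G 1 A') i.
have trE : \tr (G 1 A') = t0%:C.
  by rewrite {1}(udiag_spec th) tr_udiag// spectral_unitarymx.
have t0p : 0 < t0.
  rewrite /t0 (bigD1 (Ordinal d0))//= ltr_pwDl// sumr_ge0// => i _.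
  exact: ltW.
have tau_inv : invariant_state P ((t0^-1)%:C *: G 1 A').
  split=> [|t tge0].
    split; last by rewrite mxtraceZ trE -rmorphM mulVf ?gt_eqF.
    by apply/posdef_psd/posdefZ; rewrite ?invr_gt0.
  rewrite (superadj_semigroup P0 PD PL _ tge0) superexp_fixed//.
  by rewrite linearZ /= superadj_commutant// scaler0.
have GA : G 1 A' = t0%:C *: sigma.
  have := sigma_only tau_inv; move: (G 1 A') => Z /(congr1 (fun X => t0%:C *: X)).
  by rewrite scalerA -rmorphM divff ?gt_eqF// scale1r.
exists (t0 - k)%:C.
have G1 : G 1 1%:M = sigma.
  rewrite /Gamma mulmx1 mxpowD// (_ : 1 / 2 + 1 / 2 = 1) ?mxpow1//; by field.
have GA' : G 1 A' = G 1 (t0%:C%:M) by rewrite GA -scalemx1 GammaZ G1.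
have : A' = t0%:C%:M.
  by rewrite -[LHS](GammaNK sigma_pos 1) GA' (GammaNK sigma_pos 1).
rewrite /A' => H; rewrite -[A](addrK k%:C%:M) H.
by rewrite rmorphB raddfB.
Qed.

(** Primitivity makes the jump operators irreducible. The adjoints of the jump
    operators are jump operators, so the commutant is spanned by its
    self-adjoint elements. *)
Lemma commutant_scalar (A : M) : (forall j, comm (V j) A = 0) -> exists a, A = a%:M.
Proof.
move=> VA; have [g gi gP] := alicki_adjoint_inj LV.
have VAd j : comm (V j) (A ^t*) = 0.
  rewrite -[LHS]dagK comm_dag dagK (gP j).1 VA oppr0.
  by apply/matrixP => a b; rewrite dagE !mxE conjc0.
have [a Aa] : exists a, A + A ^t* = a%:M.
  apply: commutant_herm => [|j]; last by rewrite linearD /= VA VAd addr0.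
  by apply/hermP; rewrite dagD dagK addrC.
have [b Ab] : exists b, 'i%C *: (A - A ^t*) = b%:M.
  apply: commutant_herm => [|j]; last by rewrite linearZ linearB /= VA VAd subrr scaler0.
  apply/hermP; rewrite dagZ dagB dagK -opprB scalerN -scaleNr; congr (_ *: _).
  by apply/eqP; rewrite eq_complex /= opprK oppr0 !eqxx.
exists (2^-1 * (a - 'i%C * b)).
have -> : A = 2^-1 *: ((A + A ^t*) - 'i%C *: ('i%C *: (A - A ^t*))).
  rewrite scalerA (_ : 'i%C * 'i%C = -1); last by rewrite -expr2 sqr_i.
  move: (A ^t*) => B; apply/matrixP => i j; rewrite !mxE.
  by move: (A i j) (B i j) => x y; field.
by rewrite Aa Ab scale_scalar_mx -raddfB scale_scalar_mx.
Qed.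

End Irreducibility.

(** * The gradient *)

Section Gradient.
Context {R : realType} {d : nat}.
Local Notation C := R[i].
Local Notation M := 'M[C]_d.
Variables (p : R) (sigma : M) (L : M -> M) (J : nat) (V : 'I_J -> M).
Variables (omega c : 'I_J -> R).
Hypothesis d0 : (0 < d)%N.
Hypothesis p12 : 1 < p <= 2.
Hypothesis sigma_pos : posdef sigma.
Hypothesis LV : alicki_form sigma L V omega c.
Hypothesis irr : forall A : M, (forall j, comm (V j) A = 0) -> exists a, A = a%:M.
Variable rho : M.
Hypothesis rho_pos : posdef rho.
Local Notation D := (Dop p sigma V omega rho).
Local Notation Dinv := (Dop_inv p sigma V omega rho).
Local Notation A0 := (div_potential p sigma rho).

Lemma tangentB (A B : M) : tangent A -> tangent B -> tangent (A - B).
Proof.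
move=> [/hermP Ah At] [/hermP Bh Bt]; split; last by rewrite mxtraceB At Bt subrr.
by apply/hermP; rewrite dagB Ah Bh.
Qed.

Lemma DopB A B : D (A - B) = D A - D B.
Proof. exact: linearB. Qed.

Lemma Dop_tangent_inj A B : tangent A -> tangent B -> D A = D B -> A = B.
Proof.
move=> At Bt DAB; apply/eqP; rewrite -subr_eq0; apply/eqP.
have [_ tr0] := tangentB At Bt.
apply: (Dop_inj (omega := omega) p12 sigma_pos d0 rho_pos irr tr0).
by rewrite DopB DAB subrr.
Qed.

Lemma Dop_invP nu : tangent nu -> tangent (Dinv nu) /\ D (Dinv nu) = nu.
Proof. move=> nut; have := Dop_bij p12 sigma_pos LV d0 rho_pos irr nut.
by move=> /(@xgetPex _ 0 [set A | tangent A /\ D A = nu]). Qed.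

Lemma Dop_invE A : tangent A -> D A \is hermsymmx -> Dinv (D A) = A.
Proof.
move=> At Dh; have Dt : tangent (D A) by split=> //; exact: tr_Dop.
by have [It DI] := Dop_invP Dt; exact: Dop_tangent_inj.
Qed.

Lemma div_potential_herm : A0 \is hermsymmx.
Proof.
by apply/hermP; rewrite /div_potential dagZr Gamma_dag mxpow_dag.
Qed.

(** The potential differs from its traceless part by a scalar, which neither
    [D] nor the pairing with tangent vectors can see. *)
Definition div_potential0 : M := A0 - (complex.Re (\tr A0) / d%:R)%:C%:M.

Lemma div_potential0_tangent : tangent div_potential0.
Proof.
have /hermP Ah := div_potential_herm; split.
  by apply/hermP; rewrite /div_potential0 dagB Ah -scalemx1 dagZr dag1.
rewrite mxtraceB mxtrace_scalar.
have -> : \tr A0 = (complex.Re (\tr A0))%:C.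
  have : (\tr A0)^*%C = \tr A0 by rewrite -tr_dag Ah.
  case: (\tr A0) => x y [] /eqP; rewrite eq_sym -addr_eq0 -mulr2n mulrn_eq0 /=.
  by move=> /eqP ->.
rewrite -rmorphMn /= -mulr_natr -mulrA mulVf ?mulr1 ?subrr//.
by rewrite pnatr_eq0 -lt0n.
Qed.

Lemma Dop_potential0 : D div_potential0 = - superadj L rho.
Proof.
rewrite -(Dop_potential p12 sigma_pos LV rho_pos) /div_potential0.
rewrite DopB -scalemx1 -[RHS]subr0; congr (_ - _).
transitivity ((complex.Re (\tr A0) / d%:R)%:C *: D 1%:M); first exact: linearZ.
by rewrite Dop1 scaler0.
Qed.

Lemma superadj_tangent : tangent (- superadj L rho).
Proof.
rewrite -Dop_potential0; split; last exact: tr_Dop.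
by apply/hermP; rewrite (Dop_dag _ LV) (hermP _ div_potential0_tangent.1).
Qed.

Lemma metric_generator nu : tangent nu ->
  metric p sigma V omega rho (- superadj L rho) nu = complex.Re (hsdot A0 nu).
Proof.
move=> [nuh nu0]; rewrite /metric -Dop_potential0 Dop_invE; last first.
by rewrite Dop_potential0; case: superadj_tangent.
exact: div_potential0_tangent.
rewrite /div_potential0 hsdotBl -scalemx1 hsdotZl /hsdot dag1 mul1mx nu0.
by rewrite mulr0 subr0.
Qed.

Lemma is_grad_generator : is_grad p sigma V omega rho (- superadj L rho).
Proof.
split=> [|nu nut]; first exact: superadj_tangent.
rewrite metric_generator//; apply: is_derive_pdivergence => //.
by case: nut.
Qed.

(** The metric is nondegenerate because [D] is a bijection of the tangent
    space. *)
Lemma is_grad_unique G : is_grad p sigma V omega rho G -> G = - superadj L rho.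
Proof.
move=> [Gt dG]; have [It DI] := Dop_invP Gt.
have [Lt dL] := is_grad_generator; have [It' DI'] := Dop_invP Lt.
suff E : Dinv G = Dinv (- superadj L rho) by rewrite -DI E DI'.
apply/eqP; rewrite -subr_eq0; apply/eqP/hsdot_eq0.
set nu := _ - _; have nut : tangent nu by exact: tangentB.
have /(@derive_val _ _ _ _ _ _) G1 := dG nu nut.
have /(@derive_val _ _ _ _ _ _) L1 := dL nu nut.
have : complex.Re (hsdot nu nu) = 0.
  rewrite {1}/nu hsdotBl raddfB /= -/(metric p sigma V omega rho _ nu).
  by rewrite -/(metric p sigma V omega rho _ nu) -G1 -L1 subrr.
by move=> Re0; rewrite -[hsdot _ _]RRe_real ?Re0// ger0_real// hsdot_ge0.
Qed.

Lemma gradE : grad p sigma V omega rho = - superadj L rho.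
Proof. by apply: is_grad_unique; apply: xgetPex; eexists; exact: is_grad_generator. Qed.

End Gradient.

(** * The gradient flow *)

Theorem proposition4p3 (R : realType) (d : nat) (p : R)
    (P : R -> {linear 'M[R[i]]_d -> 'M[R[i]]_d})
    (L : {linear 'M[R[i]]_d -> 'M[R[i]]_d}) (sigma : 'M[R[i]]_d)
    (J : nat) (V : 'I_J -> 'M[R[i]]_d) (omega c : 'I_J -> R) :
  is_qms P -> is_generator P L -> primitive P sigma ->
  gns_detailed_balance sigma L -> alicki_form sigma L V omega c ->
  1 < p <= 2 ->
  forall rho : 'M[R[i]]_d, fullrank_density rho ->
  let rho_ := fun t : R => superexp t (superadj L) rho in
  forall t : R, 0 <= t ->
  [/\ fullrank_density (rho_ t),
      is_grad p sigma V omega (rho_ t) (grad p sigma V omega (rho_ t)),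
      mx_deriv_at rho_ t (- grad p sigma V omega (rho_ t))
    & - grad p sigma V omega (rho_ t) = superadj L (rho_ t)].
Proof.
move=> [P0 PD _ Pcp P1] PL [[[sigma_psd sigma_tr] sigma_inv] sigma_only sigma_rank].
move=> _ LV p12 rho [[rho_psd rho_tr] rho_rank] rho_ t t0.
have sigma_pos : posdef sigma by apply/posdefP.
have rho_pos : posdef rho by apply/posdefP.
have d0 : (0 < d)%N.
  rewrite lt0n; apply/eqP => d0; move: rho_tr => /eqP.
  rewrite /mxtrace big1 1?eq_sym ?oner_eq0// => i _.
  by have := ltn_ord i; rewrite [X in (_ < X)%N]d0.
have irr := commutant_scalar d0 P0 PD PL sigma_pos sigma_only LV.
have rhoE : rho_ t = superadj (P t) rho by rewrite /rho_ -(superadj_semigroup P0 PD PL).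
have rhot_pos : posdef (rho_ t).
  by rewrite rhoE; apply: superadj_posdef sigma_pos sigma_inv _ _ _ _.
have gradE := gradE d0 p12 sigma_pos LV irr rhot_pos.
have [rhot_psd rhot_rank] := (posdefP _).1 rhot_pos.
split; last by rewrite gradE opprK.
by split=> //; split=> //; rewrite rhoE superadj_trace.
by rewrite gradE; exact: (is_grad_generator d0 p12 sigma_pos LV irr rhot_pos).
rewrite gradE opprK.
have [B B0 KB] := mxnorm1_bound (superadj L).
exact: superexp_deriv B0 KB t rho.
Qed.
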